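(* Let $w\in S_n$ be a 1432-avoiding permutation. Then the single Grothendieck polynomial of $w$ satisfies $$\mathfrak{G}_{w}(\mathbf{x})=\sum_{T\in \mathrm{SVRT}(w,\mathbf{f}_0)}(-1)^{|T|-\ell(w)}\prod_{(i,j)\in D(w)}\ \prod_{t\in T(i,j)}x_t.$$
   Context: $S_n$ is the set of permutations $w=w_1w_2\cdots w_n$ of $\{1,\ldots,n\}$. $w$ is 1432-avoiding if there are no indices $i_1<i_2<i_3<i_4$ with $w_{i_1}<w_{i_4}<w_{i_3}<w_{i_2}$. The length $\ell(w)$ is the number of inversions, i.e. pairs $i<j$ with $w_i>w_j$. Rothe diagram: in an $n\times n$ grid, $(i,j)$ denotes the square in row $i$ (from top) and column $j$ (from left). $D(w)$ is the set of squares $(i,j)$ such that $w_i>j$ and $w_h=j$ for some $h>i$. One has $|D(w)|=\ell(w)$. Set-valued Rothe tableaux: for finite nonempty sets $A,B$ of positive integers, $A<B$ means $\max A<\min B$ and $A\le B$ means $\max A\le \min B$. A set-valued Rothe tableau $T$ of shape $D(w)$ assigns to each square $(i,j)\in D(w)$ a finite nonempty set $T(i,j)$ of positive integers such that rows are weakly decreasing from left to right ($T(i,k)\le T(i,j)$ whenever $(i,j),(i,k)\in D(w)$, $j<k$) and columns are strictly increasing from top to bottom ($T(i,j)<T(h,j)$ whenever $(i,j),(h,j)\in D(w)$, $i<h$). It is flagged by $\mathbf{f}=(f_1,\ldots,f_n)$ if every integer in row $i$ is at most $f_i$. $\mathrm{SVRT}(w,\mathbf{f})$ is the set of set-valued Rothe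 tableaux of shape $D(w)$ flagged by $\mathbf{f}$; $\mathbf{f}_0=(1,2,\ldots,n)$. $|T|=\sum_{B\in D(w)}|T(B)|$. Grothendieck polynomials: let $s_i$ be the transposition of $i$ and $i+1$; $ws_i$ is obtained from $w$ by swapping $w_i$ and $w_{i+1}$. Acting only on the $\mathbf{x}$-variables, $\partial_i f=\frac{f-s_if}{x_i-x_{i+1}}$, where $s_if$ interchanges $x_i$ and $x_{i+1}$ in $f$, and $\pi_i f=\partial_i((1-x_{i+1})f)$. For $w_0=n\,(n-1)\cdots 1$, $\mathfrak{G}_{w_0}(\mathbf{x},\mathbf{y})=\prod_{i+j\le n}(x_i+y_j-x_iy_j)$ (product over $i,j\ge1$); for $w\ne w_0$, $\mathfrak{G}_w(\mathbf{x},\mathbf{y})=\pi_i\mathfrak{G}_{ws_i}(\mathbf{x},\mathbf{y})$ for any $i$ with $\ell(ws_i)=\ell(w)+1$ (independent of the choice). The single Grothendieck polynomial $\mathfrak{G}_w(\mathbf{x})$ is obtained from $\mathfrak{G}_w(\mathbf{x},\mathbf{y})$ by setting all $y_i=0$. *)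

(* Defs.v *)
From HB Require Import structures.
From mathcomp Require Import all_boot all_order all_fingroup all_algebra.
From mathcomp Require Import zify.
From mathcomp Require Export mpoly.

Set Implicit Arguments.
Unset Strict Implicit.
Unset Printing Implicit Defensive.

Import GRing.Theory.

Local Open Scope ring_scope.

(* All indices are zero-based: the element k : 'I_n stands for the integer k+1,
   whether it is a position, a value of a permutation, the index of a variable,
   a row, a column, an entry of a tableau or a component of a flag. *)

Section Permutations.
Variable n : nat.
Implicit Type w : 'S_n.

Definition inversions w : {set 'I_n * 'I_n} :=
  [set p : 'I_n * 'I_n | (p.1 < p.2)%N && (w p.2 < w p.1)%N].

Definition perm_length w : nat := #|inversions w|.

Definition contains_1432 w : bool :=
  [exists i1 : 'I_n, exists i2 : 'I_n, exists i3 : 'I_n, exists i4 : 'I_n,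
    [&& (i1 < i2)%N, (i2 < i3)%N, (i3 < i4)%N,
        (w i1 < w i4)%N, (w i4 < w i3)%N & (w i3 < w i2)%N]].

Definition avoids_1432 w : bool := ~~ contains_1432 w.

Definition longest_perm : 'S_n := perm (@rev_ord_inj n).

Lemma adj_proof (i : 'I_n.-1) : (i.+1 < n)%N.
Proof. by rewrite -ltn_predRL. Qed.

Definition adj0 (i : 'I_n.-1) : 'I_n := widen_ord (leq_pred n) i.
Definition adj1 (i : 'I_n.-1) : 'I_n := Ordinal (adj_proof i).

Definition adj_tperm (i : 'I_n.-1) : 'S_n := tperm (adj0 i) (adj1 i).

(* Products of permutations apply the left factor first: the permutation w s_i,
   obtained from w by swapping its entries in positions i and i+1, is the
   product s_i * w here. *)
Definition swap_adj w (i : 'I_n.-1) : 'S_n := (adj_tperm i * w)%g.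

Lemma swap_adjE w i k : swap_adj w i k = w (adj_tperm i k).
Proof. by rewrite permM. Qed.

Lemma adj_tpermK i : involutive (adj_tperm i).
Proof. exact: tpermK. Qed.

Lemma adj_tperm_lt i (a b : 'I_n) :
  (a < b)%N -> (a, b) != (adj0 i, adj1 i) ->
  (adj_tperm i a < adj_tperm i b)%N.
Proof.
rewrite xpair_eqE -!val_eqE /= => ltab neqab.
have E (c : 'I_n) : adj_tperm i c =
    (if val c == i then i.+1 else if val c == i.+1 then val i else val c) :> nat.
  rewrite /adj_tperm; case: tpermP => [->|->|] /=; rewrite ?eqxx //.
    by rewrite gtn_eqF.
  by move=> /eqP; rewrite -val_eqE => /negPf /= -> /eqP;
     rewrite -val_eqE => /negPf /= ->.
rewrite !E /=; move: ltab neqab.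
move: (nat_of_ord a) (nat_of_ord b) (nat_of_ord i) => x y z {E}.
case: (x =P z) => ?; case: (x =P z.+1) => ?; case: (y =P z) => ?;
  by case: (y =P z.+1) => ?; lia.
Qed.

Lemma perm_length_swap_adj w i :
  (w (adj0 i) < w (adj1 i))%N -> perm_length (swap_adj w i) = (perm_length w).+1.
Proof.
move=> asc; pose g (p : 'I_n * 'I_n) := (adj_tperm i p.1, adj_tperm i p.2).
have gK : involutive g by move=> [a b]; rewrite /g /= !adj_tpermK.
have inj_g := inv_inj gK.
have -> : perm_length w = #|g @: inversions w| by rewrite card_imset.
rewrite /perm_length (cardsD1 (adj0 i, adj1 i)).
rewrite inE !swap_adjE /= /adj_tperm tpermL tpermR asc ltnSn add1n.
congr (_.+1); congr #|pred_of_set _|; apply/setP => p.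
rewrite -[in RHS](gK p) mem_imset // !inE !swap_adjE /=.
case: eqP => [->|/eqP np] /=.
  by rewrite /adj_tperm tpermL tpermR [X in X && _]ltnNge leqnSn.
have [->|nq] := eqVneq p (adj1 i, adj0 i).
  rewrite /adj_tperm /= tpermL tpermR [X in X && _]ltnNge leqnSn /=.
  by rewrite [X in _ = _ && X]ltnNge (ltnW asc) andbF.
congr (_ && _); apply/idP/idP => lt12.
  by apply: adj_tperm_lt; case: (p) np lt12.
rewrite -[p.1](adj_tpermK i) -[p.2](adj_tpermK i); apply: adj_tperm_lt => //.
apply: contra nq => /eqP eg; apply/eqP/inj_g.
by rewrite {1}/g eg /g /= /adj_tperm tpermL tpermR.
Qed.

Lemma exists_ascent w :
  w != longest_perm -> exists i : 'I_n.-1, (w (adj0 i) < w (adj1 i))%N.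
Proof.
move=> neq; apply/existsP; apply: contraNT neq; rewrite negb_exists => /forallP H.
have D (a b : 'I_n) : b = a.+1 :> nat -> (w b < w a)%N.
  move=> e; have lti : (a < n.-1)%N by rewrite ltn_predRL -e.
  have := H (Ordinal lti); rewrite -leqNgt leq_eqVlt.
  have -> : adj0 (Ordinal lti) = a by apply: val_inj.
  have -> : adj1 (Ordinal lti) = b by apply: val_inj.
  case/orP => // /eqP /val_inj /perm_inj eab.
  by move: e; rewrite eab => /eqP; rewrite ltn_eqF.
have U k (ltk : (k < n)%N) : (w (Ordinal ltk) + k < n)%N.
  elim: k ltk => [|k IH] ltk; first by rewrite addn0.
  have := IH (ltnW ltk); have := D (Ordinal (ltnW ltk)) (Ordinal ltk) erefl.
  lia.
have L k (ltk : (k < n)%N) : (n <= (w (Ordinal ltk) + k).+1)%N.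
  have [m em] : exists m, m = (n - k)%N by exists (n - k)%N.
  elim: m k ltk em => [|m IH] k ltk em; first by lia.
  case: (ltnP k.+1 n) => [lt1|]; last by lia.
  have := IH _ lt1 ltac:(lia); have := D (Ordinal ltk) (Ordinal lt1) erefl.
  lia.
apply/eqP/permP => -[k ltk]; apply: val_inj; rewrite permE /=.
have := U k ltk; have := L k ltk; lia.
Qed.

End Permutations.

Section DividedDifference.
Variables (R : idomainType) (n : nat).
Implicit Type f : {mpoly R[n]}.

Lemma divided_difference_subproof (i : 'I_n.-1) f :
  exists g, g * ('X_(adj0 i) - 'X_(adj1 i)) == f - msym (adj_tperm i) f.
Proof.
pose P f := exists g, g * ('X_(adj0 i) - 'X_(adj1 i)) = f - msym (adj_tperm i) f.
have PM p q : P p -> P q -> P (p * q).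
  move=> [g eg] [h eh]; exists (g * q + msym (adj_tperm i) p * h).
  rewrite mulrDl mulrAC eg -mulrA eh msymM mulrBl mulrBr addrA.
  by rewrite -addrA [- _ + _]addrC subrr addr0 || by rewrite subrK.
have PX (k : 'I_n) : P 'X_k.
  rewrite /P /msym mmapX mmap1U /adj_tperm; case: tpermP => [->|->|_ _].
  - by exists 1; rewrite mul1r.
  - by exists (-1); rewrite mulN1r opprB.
  - by exists 0; rewrite mul0r subrr.
have P1 : P 1 by exists 0; rewrite mul0r msym1 subrr.
have [g eg] : P f; last by exists g; apply/eqP.
elim/mpolyind: f => [|c m p _ _ [h eh]].
  by exists 0; rewrite mul0r msym0 subrr.
have [g eg] : P 'X_[m].
  rewrite mpolyXE_id; apply: (big_ind P) => // k _.
  by elim: (m k) => [|e IH]; rewrite ?expr0 // exprS; apply: PM.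
exists (c *: g + h); rewrite mulrDl -scalerAl eg eh msymD msymZ scalerBr.
by rewrite opprD addrACA.
Qed.

Definition divided_difference (i : 'I_n.-1) f : {mpoly R[n]} :=
  xchoose (divided_difference_subproof i f).

Lemma divided_differenceP i f :
  divided_difference i f * ('X_(adj0 i) - 'X_(adj1 i))
  = f - msym (adj_tperm i) f.
Proof. exact/eqP/(xchooseP (divided_difference_subproof i f)). Qed.

Lemma divided_difference_unique i f g :
  g * ('X_(adj0 i) - 'X_(adj1 i)) = f - msym (adj_tperm i) f ->
  g = divided_difference i f.
Proof.
rewrite -divided_differenceP; apply: mulIf; rewrite subr_eq0.
apply/eqP => /mpolyP /(_ U_(adj0 i)%MM); rewrite !mcoeffX eqxx.
case: eqP => [/mnmP /(_ (adj0 i))|_ /eqP]; last by rewrite oner_eq0.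
by rewrite !mnm1E eqxx -val_eqE /= gtn_eqF.
Qed.

Definition isobaric_difference (i : 'I_n.-1) f : {mpoly R[n]} :=
  divided_difference i ((1 - 'X_(adj1 i)) * f).

End DividedDifference.

Section Grothendieck.
Variable n : nat.
Implicit Type w : 'S_n.

(* Z[y][x]: the y-variables live in the coefficient ring, so that the operators
   above act on the x-variables only. *)
Definition dpoly := {mpoly {mpoly int[n]}[n]}.

Definition dgroth_longest : dpoly :=
  \prod_(p : 'I_n * 'I_n | (p.1.+1 + p.2.+1 <= n)%N)
    ('X_p.1 + ('X_p.2)%:MP - 'X_p.1 * ('X_p.2)%:MP).

(* [k] is fuel: each step increases the length, which is at most n ^ 2. The
   value 0 is never reached from double_grothendieck (double_grothendieck_step).
   By the braid relations, the result is the same for all choices of i. *)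
Fixpoint dgroth_rec (k : nat) w : dpoly :=
  if w == longest_perm n then dgroth_longest
  else if k is k'.+1 then
    if [pick i | perm_length (swap_adj w i) == (perm_length w).+1] is Some i
    then isobaric_difference i (dgroth_rec k' (swap_adj w i))
    else 0
  else 0.

Definition double_grothendieck w : dpoly :=
  dgroth_rec (n ^ 2 - perm_length w) w.

Lemma double_grothendieck_longest :
  double_grothendieck (longest_perm n) = dgroth_longest.
Proof. by rewrite /double_grothendieck; case: (_ - _)%N => /= *; rewrite eqxx. Qed.

Lemma perm_length_max w : (perm_length w <= n ^ 2)%N.
Proof.
rewrite /perm_length; apply: leq_trans (max_card _) _.
by rewrite card_prod card_ord mulnn.
Qed.

Lemma double_grothendieck_step w : w != longest_perm n ->
  exists2 i, perm_length (swap_adj w i) = (perm_length w).+1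
    & double_grothendieck w = isobaric_difference i (double_grothendieck (swap_adj w i)).
Proof.
move=> neq; rewrite /double_grothendieck.
have [j /perm_length_swap_adj ej] := exists_ascent neq.
have lt : (perm_length w < n ^ 2)%N by rewrite -ej perm_length_max.
rewrite -(subnSK lt) /= (negPf neq); case: pickP => [i /eqP ei|/(_ j)].
  by exists i; [exact: ei | rewrite ei].
by rewrite ej eqxx.
Qed.

Definition grothendieck w : {mpoly int[n]} :=
  map_mpoly (meval (fun=> 0)) (double_grothendieck w).

End Grothendieck.

Section SetValuedRotheTableaux.
Variable n : nat.
Implicit Types (w : 'S_n) (A B : {set 'I_n}).

Definition rothe_diagram w : {set 'I_n * 'I_n} :=
  [set p : 'I_n * 'I_n |
    (p.2 < w p.1)%N && [exists h : 'I_n, (p.1 < h)%N && (w h == p.2)]].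

Definition set_max A : nat := \max_(a in A) a.
(* The default value n is irrelevant: only used for nonempty sets. *)
Definition set_min A : nat := \big[minn/n]_(a in A) a.

Definition set_lt A B : bool := (set_max A < set_min B)%N.
Definition set_le A B : bool := (set_max A <= set_min B)%N.

(* A filling gives the empty set to the squares outside of the diagram. Since
   the flags below are bounded by n, entries range over 'I_n. *)
Definition filling := {ffun 'I_n * 'I_n -> {set 'I_n}}.

Definition rows_weakly_decreasing w (T : filling) : bool :=
  [forall i, forall j : 'I_n, forall k : 'I_n,
    [&& (i, j) \in rothe_diagram w, (i, k) \in rothe_diagram w & (j < k)%N]
      ==> set_le (T (i, k)) (T (i, j))].

Definition columns_strictly_increasing w (T : filling) : bool :=
  [forall j, forall i : 'I_n, forall h : 'I_n,
    [&& (i, j) \in rothe_diagram w, (h, j) \in rothe_diagram w & (i < h)%N]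
      ==> set_lt (T (i, j)) (T (h, j))].

Definition flagged (f : 'I_n -> 'I_n) (T : filling) : bool :=
  [forall i, forall j, forall t in T (i, j), (t <= f i)%N].

Definition SVRT w (f : 'I_n -> 'I_n) : {set filling} :=
  [set T : filling |
    [&& [forall B, (T B != set0) == (B \in rothe_diagram w)],
        rows_weakly_decreasing w T, columns_strictly_increasing w T
      & flagged f T]].

(* The flag (1, 2, ..., n). *)
Definition flag0 : 'I_n -> 'I_n := id.

(* For T in SVRT w f, this is at least the number of squares of the diagram,
   that is, perm_length w: the truncated difference of the two is exact. *)
Definition tableau_size w (T : filling) : nat :=
  (\sum_(B in rothe_diagram w) #|T B|)%N.

End SetValuedRotheTableaux.

Arguments flag0 n : clear implicits.

(* Main.v *)
Require Import Defs.
From mathcomp Require Import all_boot all_order all_fingroup all_algebra.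
From mathcomp Require Import mpoly.
From mathcomp Require Import zify ring.
(* The name adj1 also denotes a lemma on adjugate matrices. *)
Import Defs.

Set Implicit Arguments.
Unset Strict Implicit.
Unset Printing Implicit Defensive.

Import GRing.Theory.

Local Open Scope ring_scope.

(** Both sides satisfy the same recursion on the permutation, descending from
    the longest one.

    The isobaric differences satisfy the braid relations, so the Grothendieck
    polynomial of w is obtained from that of w s_i at every ascent i
    ([grothendieck_ascent]), not only at the ascent chosen by the definition.
    When w is not the longest permutation, take its first ascent, at the
    positions r and R = r + 1. Then w decreases up to position r, and this makes
    u = w s_r avoid 1432 as well ([avoids_1432_swap]). It remains to show that
    the tableau sums F satisfy the equation that defines the isobaric
    difference ([sum_SVRT_isobaric]):
      (x_r - x_R) F_w = (1 - x_R) F_u - (1 - x_r) s F_u,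
    where s exchanges the variables x_r and x_R.

    Let A be the sum over the tableaux of shape D(w) that have no entry R in
    row R to the right of column w r. The prefix of w being decreasing, the rows
    above R are left-justified, with all entries of row i equal to i by the
    flag; the diagram of u is that of w with the squares of row R beyond column
    w r moved up to row r, and one new square at (r, w r), which is forced to
    contain r alone. Hence F_u = x_r A ([sum_SVRT_swap]).

    Split F_w = P + Q, where Q gathers the tableaux with a square of row R that
    contains both r and R. Such a tableau comes in exactly one way from adding r
    to the rightmost square of row R that contains R, in a tableau that
    contributes to P but not to A. Hence Q = - x_r (P - A) ([sum_has_rR]).

    Finally, a set-valued Bender-Knuth involution shows that P and Q are
    symmetric in x_r and x_R ([msym_sum_SVRT]). Call a square free if it contains
    r or R and no other square of its column does. In each row, the involution
    reverses the order of the free squares and exchanges r and R in them. This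
    respects the row conditions because the squares of a row that contain r or R
    are, from left to right: those with an R below an r, the free ones, those
    with an r above an R. The last part of this is where 1432-avoidance enters
    ([rothe_row_below]). So Q = - x_R (P - s A) too, and the equation for F_w
    follows from these two expressions of Q. *)

(** * Braid relations of the isobaric differences *)

(** The relations between divided differences are first proved for elements of a
    commutative ring that satisfy the defining equations of quotients. Here [fi]
    stands for the image of f under the i-th transposition, [sjhi] for the image
    of [hi] under the j-th one, and so on; a, b and c, d are the two pairs of
    exchanged variables. *)
Lemma comm_quotients (A : comPzRingType) (a b c d f fi fj fij hi hj sjhi sihj hij hji : A) :
    hi * (a - b) = (1 - b) * f - (1 - a) * fi ->
    hj * (c - d) = (1 - d) * f - (1 - c) * fj ->
    sjhi * (a - b) = (1 - b) * fj - (1 - a) * fij ->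
    sihj * (c - d) = (1 - d) * fi - (1 - c) * fij ->
    hji * (c - d) = (1 - d) * hi - (1 - c) * sjhi ->
    hij * (a - b) = (1 - b) * hj - (1 - a) * sihj ->
  hij * (a - b) * (c - d) = hji * (a - b) * (c - d).
Proof.
move=> Ei Ej Eji Eij Fji Fij; rewrite Fij [RHS]mulrAC Fji.
transitivity ((1 - b) * (hj * (c - d)) - (1 - a) * (sihj * (c - d))); first by ring.
transitivity ((1 - d) * (hi * (a - b)) - (1 - c) * (sjhi * (a - b))); last by ring.
by rewrite Ei Ej Eij Eji; ring.
Qed.

(** The right-hand side is the alternating sum over the symmetric group on
    a, b, c of the images of (1 - b) (1 - c) ^+ 2 * f, that is, the numerator of
    the isobaric difference of the longest permutation; the names f21 = s2 (s1 f)
    and the like record the transpositions, the innermost one last. *)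
Lemma braid_quotients1 (A : comPzRingType)
    (a b c f f1 f2 f12 f21 f121 g g2 g12 h h1 k : A) :
    g * (a - b) = (1 - b) * f - (1 - a) * f1 ->
    g2 * (a - c) = (1 - c) * f2 - (1 - a) * f21 ->
    g12 * (b - c) = (1 - c) * f12 - (1 - b) * f121 ->
    h * (b - c) = (1 - c) * g - (1 - b) * g2 ->
    h1 * (a - c) = (1 - c) * g - (1 - a) * g12 ->
    k * (a - b) = (1 - b) * h - (1 - a) * h1 ->
  k * (a - b) * ((b - c) * (a - c)) =
    (1 - c) ^+ 2 * ((1 - b) * f - (1 - a) * f1)
    - (1 - b) ^+ 2 * ((1 - c) * f2 - (1 - a) * f21)
    + (1 - a) ^+ 2 * ((1 - c) * f12 - (1 - b) * f121).
Proof.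
move=> G G2 G12 H H1 ->.
transitivity ((1 - b) * (a - c) * (h * (b - c)) - (1 - a) * (b - c) * (h1 * (a - c))).
  by ring.
rewrite H H1 -G -G2 -G12; ring.
Qed.

(** The same numerator, from the other reduced word of the longest permutation. *)
Lemma braid_quotients2 (A : comPzRingType)
    (a b c f f1 f2 f12 f21 f121 g g1 g21 h h2 k : A) :
    g * (b - c) = (1 - c) * f - (1 - b) * f2 ->
    g1 * (a - c) = (1 - c) * f1 - (1 - a) * f12 ->
    g21 * (a - b) = (1 - b) * f21 - (1 - a) * f121 ->
    h * (a - b) = (1 - b) * g - (1 - a) * g1 ->
    h2 * (a - c) = (1 - c) * g - (1 - a) * g21 ->
    k * (b - c) = (1 - c) * h - (1 - b) * h2 ->
  k * (a - b) * ((b - c) * (a - c)) =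
    (1 - c) ^+ 2 * ((1 - b) * f - (1 - a) * f1)
    - (1 - b) ^+ 2 * ((1 - c) * f2 - (1 - a) * f21)
    + (1 - a) ^+ 2 * ((1 - c) * f12 - (1 - b) * f121).
Proof.
move=> G G1 G21 H H2 K.
transitivity ((1 - c) * (a - c) * (h * (a - b)) - (1 - b) * (a - b) * (h2 * (a - c))).
  transitivity (k * (b - c) * ((a - b) * (a - c))); first by ring.
  by rewrite K; ring.
rewrite H H2.
transitivity ((1 - b) * (1 - c) * (g * (b - c)) - (1 - a) * (1 - c) * (g1 * (a - c))
     + (1 - b) * (1 - a) * (g21 * (a - b))); first by ring.
by rewrite G G1 G21; ring.
Qed.

Lemma braid_quotients (A : idomainType) (s1 s2 : {rmorphism A -> A}) (p1 p2 : A -> A)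
    (a b c f : A) :
    s1 a = b -> s1 b = a -> s1 c = c -> s2 a = a -> s2 b = c -> s2 c = b ->
    (forall h, s1 (s2 (s1 h)) = s2 (s1 (s2 h))) ->
    (forall h, p1 h * (a - b) = (1 - b) * h - (1 - a) * s1 h) ->
    (forall h, p2 h * (b - c) = (1 - c) * h - (1 - b) * s2 h) ->
    (forall h, s1 (p1 h) = p1 h) -> (forall h, s2 (p2 h) = p2 h) ->
    a - b != 0 -> b - c != 0 -> a - c != 0 ->
  p1 (p2 (p1 f)) = p2 (p1 (p2 f)).
Proof.
move=> s1a s1b s1c s2a s2b s2c braid P1 P2 S1 S2 nab nbc nac.
have tw (s : {rmorphism A -> A}) p u v x y q r :
    p * (u - v) = (1 - x) * q - (1 - y) * r ->
    s p * (s u - s v) = (1 - s x) * s q - (1 - s y) * s r.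
  by move/(congr1 s); rewrite !(rmorphB, rmorphM, rmorph1).
apply: (mulIf nab); apply: (mulIf (mulf_neq0 nbc nac)).
have G := P1 f; have H := P2 (p1 f).
have G2 := tw s2 _ _ _ _ _ _ _ G; rewrite s2a s2b in G2.
have G12 := tw s1 _ _ _ _ _ _ _ G2; rewrite s1a s1c in G12.
have H1 := tw s1 _ _ _ _ _ _ _ H; rewrite s1b s1c S1 in H1.
rewrite (braid_quotients1 G G2 G12 H H1 (P1 _)).
have G' := P2 f; have H' := P1 (p2 f).
have G1' := tw s1 _ _ _ _ _ _ _ G'; rewrite s1b s1c in G1'.
have G21' := tw s2 _ _ _ _ _ _ _ G1'; rewrite s2a s2c -braid in G21'.
have H2' := tw s2 _ _ _ _ _ _ _ H'; rewrite s2a s2b S2 in H2'.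
by rewrite (braid_quotients2 G' G1' G21' H' H2' (P2 _)).
Qed.

Section IsobaricDifferences.
Variables (R : idomainType) (n : nat).
Implicit Types (f g : {mpoly R[n]}) (i j : 'I_n.-1).

Lemma msym_var (s : 'S_n) (k : 'I_n) : msym s ('X_k : {mpoly R[n]}) = 'X_(s k).
Proof. by rewrite /msym mmapX mmap1U. Qed.

Lemma var_inj : injective (fun k : 'I_n => 'X_k : {mpoly R[n]}).
Proof.
move=> k l /mpolyP /(_ U_(k)%MM); rewrite !mcoeffX eqxx.
case: eqP => [/mnmP /(_ k)|_ /eqP]; last by rewrite oner_eq0.
by rewrite !mnm1E eqxx; case: eqP => [->|].
Qed.

Lemma adj01_neq i : adj0 i != adj1 i.
Proof. by rewrite -val_eqE /= neq_ltn ltnSn. Qed.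

Lemma sub_adj_neq0 i : 'X_(adj0 i) - 'X_(adj1 i) != 0 :> {mpoly R[n]}.
Proof. by rewrite subr_eq0 (inj_eq var_inj) adj01_neq. Qed.

Lemma adj_tperm0 i : adj_tperm i (adj0 i) = adj1 i.
Proof. exact: tpermL. Qed.

Lemma adj_tperm1 i : adj_tperm i (adj1 i) = adj0 i.
Proof. exact: tpermR. Qed.

Lemma msym_adjK i : involutive (msym (adj_tperm i) : {mpoly R[n]} -> _).
Proof. by move=> f; rewrite -msymMm tperm2 msym1m. Qed.

Lemma isobaric_differenceP i f :
  isobaric_difference i f * ('X_(adj0 i) - 'X_(adj1 i)) =
  (1 - 'X_(adj1 i)) * f - (1 - 'X_(adj0 i)) * msym (adj_tperm i) f.
Proof.
rewrite divided_differenceP; congr (_ - _).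
by rewrite msymM msymB msym1 msym_var adj_tperm1.
Qed.

Lemma isobaric_difference_unique i f g :
  g * ('X_(adj0 i) - 'X_(adj1 i)) =
    (1 - 'X_(adj1 i)) * f - (1 - 'X_(adj0 i)) * msym (adj_tperm i) f ->
  g = isobaric_difference i f.
Proof.
by move=> e; apply: (mulIf (sub_adj_neq0 i)); rewrite isobaric_differenceP.
Qed.

Lemma isobaric_difference_sym i f :
  msym (adj_tperm i) (isobaric_difference i f) = isobaric_difference i f.
Proof.
apply: isobaric_difference_unique.
have := congr1 (msym (adj_tperm i)) (isobaric_differenceP i f).
rewrite msymM !msymB !msymM !msymB msym1 !msym_var msym_adjK adj_tperm0 adj_tperm1.
by move=> e; rewrite -opprB mulrN e opprB.
Qed.

Lemma adj_tperm_far i (k : 'I_n) : k != adj0 i -> k != adj1 i -> adj_tperm i k = k.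
Proof. by move=> h0 h1; rewrite /adj_tperm tpermD // eq_sym. Qed.

Lemma adj_tperm_braid i j : j = i.+1 :> nat ->
  (adj_tperm i * (adj_tperm j * adj_tperm i) =
   adj_tperm j * (adj_tperm i * adj_tperm j))%g.
Proof.
move=> eij; have e : adj0 j = adj1 i by apply: val_inj; rewrite /= eij.
have ac : adj0 i != adj1 j by rewrite -val_eqE /= neq_ltn; apply/orP; left; lia.
have ab := adj01_neq i; have bc := adj01_neq j; rewrite e in bc.
have s1c : adj_tperm i (adj1 j) = adj1 j by rewrite adj_tperm_far // eq_sym.
have s2a : adj_tperm j (adj0 i) = adj0 i by rewrite adj_tperm_far // e.
have s2b : adj_tperm j (adj1 i) = adj1 j by rewrite -e adj_tperm0.
have s2c : adj_tperm j (adj1 j) = adj1 i by rewrite -e adj_tperm1.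
apply/permP => k; rewrite !permM.
have [->|k0] := eqVneq k (adj0 i).
  by rewrite !(s1c, s2a, s2b, s2c, e, adj_tperm0, adj_tperm1).
have [->|k1] := eqVneq k (adj1 i).
  by rewrite !(s1c, s2a, s2b, s2c, e, adj_tperm0, adj_tperm1).
have [->|k2] := eqVneq k (adj1 j).
  by rewrite !(s1c, s2a, s2b, s2c, e, adj_tperm0, adj_tperm1).
have ei : adj_tperm i k = k by apply: adj_tperm_far.
have ej : adj_tperm j k = k by apply: adj_tperm_far => //; rewrite e.
by rewrite !(ei, ej).
Qed.

Lemma adj_tperm_comm i j : (i.+1 < j)%N ->
  (adj_tperm i * adj_tperm j = adj_tperm j * adj_tperm i)%g.
Proof.
move=> ltij.
have far (k l : 'I_n) : (k < l)%N -> k != l by rewrite -val_eqE /= neq_ltn => ->.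
have e00 : adj0 i != adj0 j by apply: far => /=; lia.
have e01 : adj0 i != adj1 j by apply: far => /=; lia.
have e10 : adj1 i != adj0 j by apply: far => /=; lia.
have e11 : adj1 i != adj1 j by apply: far => /=; lia.
apply/permP => k; rewrite !permM.
have [->|k0] := eqVneq k (adj0 i); first by rewrite adj_tperm0 !(adj_tperm_far _ (i:=j)) ?adj_tperm0.
have [->|k1] := eqVneq k (adj1 i); first by rewrite adj_tperm1 !(adj_tperm_far _ (i:=j)) ?adj_tperm1.
rewrite (adj_tperm_far k0 k1) [RHS]adj_tperm_far //.
- by rewrite /adj_tperm; case: tpermP => [?|?|//]; rewrite eq_sym.
- by rewrite /adj_tperm; case: tpermP => [?|?|//]; rewrite eq_sym.
Qed.

Lemma isobaric_difference_comm i j f : (i.+1 < j)%N ->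
  isobaric_difference i (isobaric_difference j f) =
  isobaric_difference j (isobaric_difference i f).
Proof.
move=> ltij.
have far (k l : 'I_n) : (k < l)%N -> k != l by rewrite -val_eqE /= neq_ltn => ->.
have e00 : adj0 i != adj0 j by apply: far => /=; lia.
have e01 : adj0 i != adj1 j by apply: far => /=; lia.
have e10 : adj1 i != adj0 j by apply: far => /=; lia.
have e11 : adj1 i != adj1 j by apply: far => /=; lia.
have cc := adj_tperm_comm ltij.
apply: (mulIf (sub_adj_neq0 i)); apply: (mulIf (sub_adj_neq0 j)).
have Si := isobaric_differenceP i f; have Sj := isobaric_differenceP j f.
have Ti := congr1 (msym (adj_tperm j)) Si; have Tj := congr1 (msym (adj_tperm i)) Sj.
move: Ti Tj; rewrite !(msymM, msymB, msym1, msym_var) -!msymMm cc.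
have i0 : adj_tperm i (adj0 j) = adj0 j by apply: adj_tperm_far; rewrite eq_sym.
have i1 : adj_tperm i (adj1 j) = adj1 j by apply: adj_tperm_far; rewrite eq_sym.
have j0 : adj_tperm j (adj0 i) = adj0 i by apply: adj_tperm_far.
have j1 : adj_tperm j (adj1 i) = adj1 i by apply: adj_tperm_far.
rewrite i0 i1 j0 j1.
move=> Ti Tj; apply: (comm_quotients Si Sj Ti Tj); exact: isobaric_differenceP.
Qed.

Lemma isobaric_difference_braid i j f : j = i.+1 :> nat ->
  isobaric_difference i (isobaric_difference j (isobaric_difference i f)) =
  isobaric_difference j (isobaric_difference i (isobaric_difference j f)).
Proof.
move=> eij.
have e : adj0 j = adj1 i by apply: val_inj; rewrite /= eij.
have ac : adj0 i != adj1 j by rewrite -val_eqE /= neq_ltn; apply/orP; left; lia.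
have ab := adj01_neq i; have bc := adj01_neq j; rewrite e in bc.
have s1c : adj_tperm i (adj1 j) = adj1 j by rewrite adj_tperm_far // eq_sym.
have s2a : adj_tperm j (adj0 i) = adj0 i by rewrite adj_tperm_far // e.
have s2b : adj_tperm j (adj1 i) = adj1 j by rewrite -e adj_tperm0.
have s2c : adj_tperm j (adj1 j) = adj1 i by rewrite -e adj_tperm1.
apply: (braid_quotients (s1 := msym (adj_tperm i)) (s2 := msym (adj_tperm j))
    (a := 'X_(adj0 i)) (b := 'X_(adj1 i)) (c := 'X_(adj1 j))).
- by rewrite /= msym_var adj_tperm0.
- by rewrite /= msym_var adj_tperm1.
- by rewrite /= msym_var s1c.
- by rewrite /= msym_var s2a.
- by rewrite /= msym_var s2b.
- by rewrite /= msym_var s2c.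
- by move=> h /=; rewrite -!msymMm adj_tperm_braid.
- by move=> h; exact: isobaric_differenceP.
- by move=> h; have := isobaric_differenceP j h; rewrite e.
- by move=> h; exact: isobaric_difference_sym.
- by move=> h; exact: isobaric_difference_sym.
- exact: sub_adj_neq0.
- by have := sub_adj_neq0 j; rewrite e.
- by rewrite subr_eq0 (inj_eq var_inj).
Qed.
End IsobaricDifferences.

(** * Recursion for Grothendieck polynomials at an arbitrary ascent *)

Section Recursion.
Variable n : nat.
Implicit Types (w : 'S_n) (i j : 'I_n.-1).

Lemma swap_adjK w i : swap_adj (swap_adj w i) i = w.
Proof. by rewrite /swap_adj mulgA tperm2 mul1g. Qed.

Lemma ascent_of_length w i :
  perm_length (swap_adj w i) = (perm_length w).+1 -> (w (adj0 i) < w (adj1 i))%N.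
Proof.
move=> e; rewrite ltnNge; apply/negP => le.
have /perm_length_swap_adj : (swap_adj w i (adj0 i) < swap_adj w i (adj1 i))%N.
  rewrite !swap_adjE adj_tperm0 adj_tperm1 ltn_neqAle le andbT.
  by rewrite (inj_eq val_inj) (inj_eq perm_inj) eq_sym adj01_neq.
by rewrite swap_adjK e; lia.
Qed.

(** Two ascents of w are joined by a square or a hexagon in the weak order, and
    the commutation or braid relation says that both ways around it give the same
    polynomial. *)
Lemma isobaric_difference_diamond (g : 'S_n -> dpoly n) w i j :
  (forall v k, (perm_length w < perm_length v)%N -> (v (adj0 k) < v (adj1 k))%N ->
    g v = isobaric_difference k (g (swap_adj v k))) ->
  (w (adj0 i) < w (adj1 i))%N -> (w (adj0 j) < w (adj1 j))%N ->
  isobaric_difference i (g (swap_adj w i)) = isobaric_difference j (g (swap_adj w j)).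
Proof.
move=> IH; wlog ltij : i j / (i < j)%N => [th|] ai aj.
  by case: (ltngtP i j) => [||/val_inj ->//] h; [|apply/esym]; apply: th.
have up (v : 'S_n) k : (v (adj0 k) < v (adj1 k))%N -> (perm_length v < perm_length (swap_adj v k))%N.
  by move=> /perm_length_swap_adj ->; exact: ltnSn.
have li := up _ _ ai; have lj := up _ _ aj.
have nv (k l : 'I_n) : val k != val l -> k != l by [].
have [gap|] := ltnP i.+1 j.
  have e00 : adj0 j != adj0 i by apply: nv => /=; lia.
  have e01 : adj0 j != adj1 i by apply: nv => /=; lia.
  have e10 : adj1 j != adj0 i by apply: nv => /=; lia.
  have e11 : adj1 j != adj1 i by apply: nv => /=; lia.
  have i0 : adj_tperm i (adj0 j) = adj0 j by apply: adj_tperm_far.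
  have i1 : adj_tperm i (adj1 j) = adj1 j by apply: adj_tperm_far.
  have j0 : adj_tperm j (adj0 i) = adj0 i by apply: adj_tperm_far; rewrite eq_sym.
  have j1 : adj_tperm j (adj1 i) = adj1 i by apply: adj_tperm_far; rewrite eq_sym.
  have aij : (swap_adj w i (adj0 j) < swap_adj w i (adj1 j))%N by rewrite !swap_adjE i0 i1.
  have aji : (swap_adj w j (adj0 i) < swap_adj w j (adj1 i))%N by rewrite !swap_adjE j0 j1.
  rewrite (IH _ _ li aij) (IH _ _ lj aji).
  have es : swap_adj (swap_adj w i) j = swap_adj (swap_adj w j) i.
    by rewrite /swap_adj !mulgA (adj_tperm_comm gap).
  by rewrite (isobaric_difference_comm _ gap) es.
move=> le; have eij : j = i.+1 :> nat by lia.
have e : adj0 j = adj1 i by apply: val_inj; rewrite /= eij.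
have ac : adj0 i != adj1 j by apply: nv => /=; lia.
have s1c : adj_tperm i (adj1 j) = adj1 j.
  by rewrite adj_tperm_far // 1?eq_sym // -e adj01_neq.
have s2a : adj_tperm j (adj0 i) = adj0 i by rewrite adj_tperm_far // e adj01_neq.
have s2b : adj_tperm j (adj1 i) = adj1 j by rewrite -e adj_tperm0.
have s2c : adj_tperm j (adj1 j) = adj1 i by rewrite -e adj_tperm1.
have simpls := (swap_adjE, s1c, s2a, s2b, s2c, e, adj_tperm0, adj_tperm1).
rewrite e in aj; have wij := ltn_trans ai aj.
have aij : (swap_adj w i (adj0 j) < swap_adj w i (adj1 j))%N by rewrite !simpls.
have aji : (swap_adj w j (adj0 i) < swap_adj w j (adj1 i))%N by rewrite !simpls.
have lij := ltn_trans li (up _ _ aij); have lji := ltn_trans lj (up _ _ aji).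
have aiji : (swap_adj (swap_adj w i) j (adj0 i) < swap_adj (swap_adj w i) j (adj1 i))%N.
  by rewrite !simpls.
have ajij : (swap_adj (swap_adj w j) i (adj0 j) < swap_adj (swap_adj w j) i (adj1 j))%N.
  by rewrite !simpls.
rewrite (IH _ _ li aij) (IH _ _ lij aiji) (IH _ _ lj aji) (IH _ _ lji ajij).
have es : swap_adj (swap_adj (swap_adj w i) j) i = swap_adj (swap_adj (swap_adj w j) i) j.
  by have := adj_tperm_braid eij; rewrite /swap_adj !mulgA => ->.
apply: etrans (isobaric_difference_braid _ eij) _.
exact: (congr1 (fun v => isobaric_difference j
  (isobaric_difference i (isobaric_difference j (g v)))) es).
Qed.

(** By induction on the colength, the diamond property carries the recursion
    from the ascent picked by the definition to any other one. *)
Lemma double_grothendieck_ascent w i : (w (adj0 i) < w (adj1 i))%N ->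
  double_grothendieck w = isobaric_difference i (double_grothendieck (swap_adj w i)).
Proof.
have [m lem] := ubnP (n ^ 2 - perm_length w); elim: m w i lem => // m IH w i lem ai.
have nw : w != longest_perm n.
  by apply: contraTneq ai => ->; rewrite !permE /= -leqNgt; lia.
have [j ej ->] := double_grothendieck_step nw.
apply: isobaric_difference_diamond => // [v k lv|]; last exact: ascent_of_length.
by apply: IH; have := perm_length_max v; lia.
Qed.

Lemma map_mpoly_isobaric (R S : idomainType) (phi : {rmorphism R -> S}) i (f : {mpoly R[n]}) :
  map_mpoly phi (isobaric_difference i f) = isobaric_difference i (map_mpoly phi f).
Proof.
apply: isobaric_difference_unique.
have map_msym s (p : {mpoly R[n]}) : map_mpoly phi (msym s p) = msym s (map_mpoly phi p).
  by apply/mpolyP => m; rewrite mcoeff_map_mpoly !mcoeff_sym mcoeff_map_mpoly.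
have := congr1 (map_mpoly phi) (isobaric_differenceP i f).
by rewrite !(rmorphM, rmorphB) /= rmorph1 !map_mpolyX map_msym.
Qed.

(** The specialization of the y-variables acts on coefficients, and so commutes
    with the operators on the x-variables. *)
Lemma grothendieck_ascent w i : (w (adj0 i) < w (adj1 i))%N ->
  grothendieck w = isobaric_difference i (grothendieck (swap_adj w i)).
Proof. by move=> /double_grothendieck_ascent e; rewrite /grothendieck e map_mpoly_isobaric. Qed.

Lemma grothendieck_longest :
  grothendieck (longest_perm n) =
  \prod_(p : 'I_n * 'I_n | (p.1.+1 + p.2.+1 <= n)%N) 'X_p.1.
Proof.
rewrite /grothendieck double_grothendieck_longest rmorph_prod; apply: eq_bigr => p _.
rewrite rmorphB rmorphM rmorphD /= map_mpolyC map_mpolyX /= mevalXU.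
by rewrite mpolyC0 mulr0 addr0 subr0.
Qed.

End Recursion.

(** * Set-valued Rothe tableaux: entries, weights, frozen squares *)

Section Tableaux.
Variable n : nat.
Implicit Types (w : 'S_n) (A B : {set 'I_n}) (T : filling n).

Lemma in_rothe w (i j : 'I_n) :
  ((i, j) \in rothe_diagram w) = (j < w i)%N && (i < (w^-1)%g j)%N.
Proof.
rewrite inE /=; congr (_ && _); apply/existsP/idP => [[h /andP[ih /eqP <-]]|ih].
  by rewrite permK.
by exists ((w^-1)%g j); rewrite ih permKV eqxx.
Qed.

Lemma card_rothe w : #|rothe_diagram w| = perm_length w.
Proof.
pose g (p : 'I_n * 'I_n) := (p.1, w p.2).
have inj_g : injective g by move=> [a b] [c d] [-> /perm_inj ->].
rewrite /perm_length -[RHS](card_imset _ inj_g); congr #|pred_of_set _|.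
apply/setP => -[i j]; rewrite in_rothe; apply/andP/imsetP => [[ji ij]|[[a b]]].
  by exists (i, (w^-1)%g j); rewrite ?inE /g /= ?permKV // ij ji.
by rewrite inE /= => /andP[ab ba] [-> ->]; rewrite permK.
Qed.

Lemma leq_set_max A m : (set_max A <= m)%N = [forall s in A, (s <= m)%N].
Proof. by apply/bigmax_leqP/forall_inP. Qed.

Lemma leq_set_min B m : (m <= n)%N -> (m <= set_min B)%N = [forall t in B, (m <= t)%N].
Proof.
move=> mn; apply/idP/forall_inP => [le t tB|le].
  apply: leq_trans le _; rewrite /set_min; have := mem_index_enum t.
  elim: (index_enum _) => // x r IH; rewrite inE big_cons => /orP[/eqP <-|/IH le].
    by rewrite tB geq_minl.
  by case: ifP => // _; apply: leq_trans (geq_minr _ _) le.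
by rewrite /set_min; elim/big_rec: _ => // t m' tB le'; rewrite leq_min le // le'.
Qed.

Lemma set_leP A B :
  reflect (forall s t, s \in A -> t \in B -> (s <= t)%N) (set_le A B).
Proof.
have mn : (set_max A <= n)%N by rewrite leq_set_max; apply/forall_inP => s _; apply: ltnW.
rewrite /set_le leq_set_min //; apply: (iffP forall_inP) => [H s t sA tB|H t tB].
  by have := H t tB; rewrite leq_set_max => /forall_inP /(_ s sA).
by rewrite leq_set_max; apply/forall_inP => s sA; apply: H.
Qed.

Lemma set_ltP A B : A != set0 ->
  reflect (forall s t, s \in A -> t \in B -> (s < t)%N) (set_lt A B).
Proof.
move/set0Pn => ne; have n_gt0 : (0 < n)%N by case: ne => a _; exact: leq_ltn_trans (ltn_ord a).
have mn : (set_max A < n)%N.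
  have : (set_max A <= n.-1)%N.
    by rewrite leq_set_max; apply/forall_inP => s _; have := ltn_ord s; lia.
  lia.
rewrite /set_lt leq_set_min //; apply: (iffP forall_inP) => [H s t sA tB|H t tB].
  apply: leq_ltn_trans (H t tB).
  exact: (@leq_bigmax_cond _ (mem A) (fun a : 'I_n => a : nat)).
case: ne => a aA; have t_gt0 : (0 < t)%N by apply: leq_ltn_trans (H a t aA tB).
have : (set_max A <= t.-1)%N.
  by rewrite leq_set_max; apply/forall_inP => s sA; have := H s t sA tB; lia.
lia.
Qed.

Lemma SVRTP w T : reflect
  [/\ forall (i j : 'I_n), (T (i, j) != set0) = ((i, j) \in rothe_diagram w),
      forall (i j k s t : 'I_n), (j < k)%N -> s \in T (i, k) -> t \in T (i, j) -> (s <= t)%N,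
      forall (i h j s t : 'I_n), (i < h)%N -> s \in T (i, j) -> t \in T (h, j) -> (s < t)%N
    & forall (i j t : 'I_n), t \in T (i, j) -> (t <= i)%N]
  (T \in SVRT w (flag0 n)).
Proof.
have ne0 (C : {set 'I_n}) c : c \in C -> C != set0 by move=> cC; apply/set0Pn; exists c.
rewrite inE; apply: (iffP and4P) => [[/forallP S /forallP Rw /forallP Cl /forallP F]|[S Rw Cl F]].
  have S' i j : (T (i, j) != set0) = ((i, j) \in rothe_diagram w) by rewrite (eqP (S (i, j))).
  split=> [//|i j k s t jk si ti|i h j s t ih si ti|i j t ti].
  - have /forallP/(_ j)/forallP/(_ k) := Rw i; rewrite -!S' jk (ne0 _ _ si) (ne0 _ _ ti).
    by move/set_leP; apply.
  - have /forallP/(_ i)/forallP/(_ h) := Cl j; rewrite -!S' ih (ne0 _ _ si) (ne0 _ _ ti).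
    by move/(set_ltP _ (ne0 _ _ si)); apply.
  - by have /forallP/(_ j)/forallP/(_ t)/implyP := F i; apply.
split.
- by apply/forallP => -[i j]; rewrite S.
- apply/forallP => i; apply/forallP => j; apply/forallP => k; apply/implyP => /and3P[_ _ jk].
  by apply/set_leP => s t; apply: Rw.
- apply/forallP => j; apply/forallP => i; apply/forallP => h; apply/implyP => /and3P[d _ ih].
  by apply/set_ltP => [|s t]; [rewrite S | apply: Cl].
- by apply/forallP => i; apply/forallP => j; apply/forall_inP => t; apply: F.
Qed.

Definition occurrences T (t : 'I_n) : nat := #|[set B | t \in T B]|.

(** The signed monomial of a tableau, with the sign distributed over the
    entries. It depends on the tableau only through the number of occurrences of
    each entry, so that a bijection of tableaux need only be followed through
    these numbers. *)
Definition weight w T : {mpoly int[n]} :=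
  (-1) ^+ perm_length w * \prod_t (- 'X_t) ^+ occurrences T t.

Lemma weightE w T : T \in SVRT w (flag0 n) ->
  (-1) ^+ (tableau_size w T - perm_length w) *
    \prod_(B in rothe_diagram w) \prod_(t in T B) 'X_t = weight w T.
Proof.
case/SVRTP => S _ _ _; rewrite /weight.
have -> : \prod_t (- 'X_t) ^+ occurrences T t =
    (-1) ^+ tableau_size w T *
    \prod_(B in rothe_diagram w) \prod_(t in T B) 'X_t :> {mpoly int[n]}.
  rewrite (eq_bigr (fun t => \prod_(B | t \in T B) (- 'X_t))); last first.
    by move=> t _; rewrite prodr_const /occurrences cardsE.
  rewrite (exchange_big_dep predT) //= /tableau_size -prodrXr -big_split /=.
  rewrite [RHS]big_mkcond; apply: eq_bigr => -[i j] _.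
  rewrite -S; case: eqP => [->|_] /=; first by rewrite big_set0.
  by rewrite prodrN.
rewrite mulrA -signr_odd -[X in _ = X * _]exprD -[X in _ = X * _]signr_odd.
rewrite oddD oddB; first by rewrite addbC.
rewrite -card_rothe /tableau_size -sum1_card; apply: leq_sum => -[i j].
by rewrite -S card_gt0.
Qed.

(** Strictness of the column forces the entries to be at least their row index,
    and the flag forces them to be at most that. *)
Lemma frozen w T (h j t : 'I_n) : T \in SVRT w (flag0 n) ->
  (forall p : 'I_n, (p <= h)%N -> (p, j) \in rothe_diagram w) ->
  t \in T (h, j) -> t = h.
Proof.
case/SVRTP => S _ Cl F full tT; apply/val_inj/eqP; rewrite eqn_leq (F _ _ _ tT) /=.
have [m em] : exists m, m = h :> nat by exists h.
elim: m h t em full tT => [|m IH] h t em full tT; first by rewrite -em.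
have mn : (m < n)%N by apply: ltn_trans (ltn_ord h); rewrite -em.
have := full (Ordinal mn); rewrite -S /= => /(_ ltac:(lia))/set0Pn[t' t'T].
have := IH (Ordinal mn) t' erefl _ t'T => /(_ ltac:(move=> p /= ?; apply: full; lia)).
have := Cl (Ordinal mn) h j t' t _ t'T tT => /= /(_ ltac:(lia)).
lia.
Qed.

Lemma avoids_1432P w : avoids_1432 w ->
  forall p1 p2 p3 p4 : 'I_n, (p1 < p2)%N -> (p2 < p3)%N -> (p3 < p4)%N ->
  (w p1 < w p4)%N -> (w p4 < w p3)%N -> (w p3 < w p2)%N -> False.
Proof.
move=> av p1 p2 p3 p4 h1 h2 h3 h4 h5 h6; move/negP: av; apply.
apply/existsP; exists p1; apply/existsP; exists p2; apply/existsP; exists p3.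
by apply/existsP; exists p4; rewrite h1 h2 h3 h4 h5 h6.
Qed.

Section Mirror.
Variable C : {set 'I_n}.
Implicit Types j k : 'I_n.

(** The order-reversing permutation of C. *)
Definition mirror j : 'I_n := nth j (rev (enum C)) (index j (enum C)).

Lemma mirror_nth j : j \in C ->
  mirror j = nth j (enum C) (size (enum C) - (index j (enum C)).+1).
Proof. by move=> jC; rewrite /mirror nth_rev // index_mem mem_enum. Qed.

Lemma index_enum_bound j : j \in C -> (index j (enum C) < size (enum C))%N.
Proof. by rewrite index_mem mem_enum. Qed.

Lemma rev_bound (a b : nat) : (a < b)%N -> (b - a.+1 < b)%N.
Proof. by case: b => // b _; rewrite subSS ltnS leq_subr. Qed.

Lemma mirror_in j : j \in C -> mirror j \in C.
Proof.
move=> jC; rewrite mirror_nth // -mem_enum mem_nth //.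
exact: rev_bound (index_enum_bound jC).
Qed.

Lemma index_mirror j : j \in C ->
  index (mirror j) (enum C) = (size (enum C) - (index j (enum C)).+1)%N.
Proof.
move=> jC; rewrite mirror_nth // index_uniq ?enum_uniq //.
exact: rev_bound (index_enum_bound jC).
Qed.

Lemma mirrorK j : j \in C -> mirror (mirror j) = j.
Proof.
move=> jC; rewrite (mirror_nth (mirror_in jC)) index_mirror //.
rewrite -[RHS](nth_index (mirror j) (s := enum C)) ?mem_enum //; congr nth.
have := index_enum_bound jC; move: (index _ _) (size _) => a b; lia.
Qed.

Lemma index_enum_lt j k : j \in C -> k \in C ->
  (index j (enum C) < index k (enum C))%N = (j < k)%N.
Proof.
have so : sorted (fun a b : 'I_n => (a < b)%N) (enum C).
  rewrite /enum_mem; apply: sorted_filter; first by move=> a b c; apply: ltn_trans.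
  by rewrite -enumT -(sorted_map (f := val) (e' := ltn)) val_enum_ord iota_ltn_sorted.
have tr : transitive (fun a b : 'I_n => (a < b)%N) by move=> a b c; apply: ltn_trans.
have half a b : a \in C -> b \in C -> (index a (enum C) < index b (enum C))%N -> (a < b)%N.
  move=> aC bC lt; have := sorted_ltn_nth tr a so _ _ _ _ lt.
  by rewrite !inE !index_enum_bound // !nth_index ?mem_enum //; apply.
move=> jC kC; apply/idP/idP; first exact: half.
move=> jk; case: ltngtP => // [/half|/index_inj]; first by move=> /(_ kC jC); lia.
by rewrite !mem_enum => /(_ j jC kC) e; rewrite e ltnn in jk.
Qed.

Lemma mirror_lt j k : j \in C -> k \in C -> (j < k)%N -> (mirror k < mirror j)%N.
Proof.
move=> jC kC; rewrite -!index_enum_lt ?mirror_in // !index_mirror //.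
have := index_enum_bound jC; have := index_enum_bound kC.
by move: (index j _) (index k _) (size _) => a b c; lia.
Qed.

End Mirror.

End Tableaux.

(** * The Bender-Knuth involution *)

Section BenderKnuth.
Variables (n : nat) (w : 'S_n) (r R : 'I_n).
Hypotheses (w_avoids : avoids_1432 w) (Rr : R = r.+1 :> nat) (asc : (w r < w R)%N).
Implicit Types (T : filling n) (B : 'I_n * 'I_n) (h j k t : 'I_n).

Definition meets T B : bool := (r \in T B) || (R \in T B).

(** The squares in which r and R can be exchanged without looking at the rest
    of the column. *)
Definition free T B : bool :=
  meets T B && [forall h, (h != B.1) ==> ~~ meets T (h, B.2)].

Definition mirror_square T B : 'I_n * 'I_n :=
  (B.1, mirror [set k | free T (B.1, k)] B.2).

(** Reversing a weakly decreasing row word in the letters R, rR, r and then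
    exchanging r and R gives a weakly decreasing word again. The other entries of
    the square stay in place. *)
Definition bender_knuth T : filling n :=
  [ffun B => if free T B
    then [set t | if (t == r) || (t == R) then tperm r R t \in T (mirror_square T B)
                  else t \in T B]
    else T B].

Lemma neq_perm (p q : 'I_n) : (p < q)%N || (q < p)%N -> w p != w q.
Proof. by apply: contraL => /eqP/perm_inj ->; rewrite ltnn. Qed.

(** This is the only use of 1432-avoidance in the construction of the
    involution. If some value smaller than k precedes position h, then together
    with the values at h, h' (or j) and k it would form the pattern 1432 unless
    (h', j) is in the diagram. Otherwise column k is full down to row h, so (h, k)
    is frozen and h = r; this forces h' = R, where the ascent gives the claim. *)
Lemma rothe_row_below T h h' k j : T \in SVRT w (flag0 n) ->
  (h < h')%N -> r \in T (h, k) -> R \in T (h', k) -> (k < j)%N ->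
  (h, j) \in rothe_diagram w -> (h', j) \in rothe_diagram w.
Proof.
move=> Tw hh' rT RT kj; have [S Rw Cl F] := SVRTP _ _ Tw.
have dhk : (h, k) \in rothe_diagram w by rewrite -S; apply/set0Pn; exists r.
have dh'k : (h', k) \in rothe_diagram w by rewrite -S; apply/set0Pn; exists R.
have [/existsP[p /andP[ph wpk]]|/existsPn noP] :=
  boolP [exists p : 'I_n, (p < h)%N && (w p < k)%N].
  move: dhk dh'k; rewrite !in_rothe => /andP[kh hk] /andP[kh' h'k] /andP[jh hj].
  have wk : w ((w^-1)%g k) = k by rewrite permKV.
  have wj : w ((w^-1)%g j) = j by rewrite permKV.
  have lt : (w h < w h')%N.
    rewrite ltnNge leq_eqVlt (inj_eq val_inj) negb_or neq_perm ?hh' ?orbT //=.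
    apply/negP => lt; apply: (avoids_1432P w_avoids ph hh' h'k); rewrite ?wk //.
  rewrite (ltn_trans jh lt) /= ltnNge leq_eqVlt; apply/negP => /orP[/eqP/val_inj e|l].
    by move: jh lt; rewrite -e wj; lia.
  apply: (avoids_1432P w_avoids ph hj (ltn_trans l h'k)); rewrite ?wk ?wj //.
have full (p : 'I_n) : (p <= h)%N -> (p, k) \in rothe_diagram w.
  rewrite leq_eqVlt => /orP[/eqP/val_inj -> //|ph].
  move: dhk; rewrite !in_rothe => /andP[kh hk]; rewrite (ltn_trans ph hk) andbT.
  have := noP p; rewrite ph /= -leqNgt leq_eqVlt => /orP[/eqP/val_inj e|//].
  by move: hk; rewrite e permK; lia.
have eh := frozen Tw full rT; subst h.
move: (dhk) (dh'k); rewrite !in_rothe => /andP[kr rk] /andP[kh' h'k] /andP[jr rj].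
have neR (l : 'I_n) : (l < w r)%N -> (w^-1)%g l != R.
  by apply: contraTneq => e; rewrite -leqNgt -[l](permKV w) e ltnW.
have dR (l : 'I_n) : (l < w r)%N -> (r < (w^-1)%g l)%N -> (R, l) \in rothe_diagram w.
  move=> lr rl; rewrite in_rothe (ltn_trans lr asc) /= ltn_neqAle eq_sym neR //=.
  by rewrite Rr.
have [e|nR] := eqVneq h' R; first by rewrite e; have := dR j jr rj; rewrite in_rothe.
have RR : (R < h')%N by rewrite ltn_neqAle eq_sym nR /= Rr.
have := dR k kr rk; rewrite -S => /set0Pn[t tT].
have := Cl _ _ _ _ _ RR tT RT; have := Cl r R k r t; rewrite Rr => /(_ (ltnSn r) rT tT).
lia.
Qed.

(** As r and R are consecutive, any other entry is on the same side of both. *)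
Lemma pair_below c s t : (c == r) || (c == R) -> (s == r) || (s == R) ->
  ~~ ((t == r) || (t == R)) -> (c <= t)%N -> (s < t)%N.
Proof.
rewrite negb_or -!(inj_eq val_inj) /= Rr => /orP c_rR /orP s_rR /andP[/eqP n1 /eqP n2] ct.
by case: c_rR => /eqP ec; case: s_rR => /eqP es; rewrite es; lia.
Qed.

Lemma pair_above c s t : (c == r) || (c == R) -> (s == r) || (s == R) ->
  ~~ ((t == r) || (t == R)) -> (t <= c)%N -> (t < s)%N.
Proof.
rewrite negb_or -!(inj_eq val_inj) /= Rr => /orP c_rR /orP s_rR /andP[/eqP n1 /eqP n2] ct.
by case: c_rR => /eqP ec; case: s_rR => /eqP es; rewrite es; lia.
Qed.

Lemma pair_bounds c : (c == r) || (c == R) -> (r <= c)%N && (c <= R)%N.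
Proof. by case/orP => /eqP ->; rewrite Rr leqnn ?leqnSn. Qed.

Lemma meetsP T B : reflect (exists2 t, t \in T B & (t == r) || (t == R)) (meets T B).
Proof.
apply: (iffP orP) => [[rT|RT]|[t tT /orP[/eqP e|/eqP e]]].
- by exists r => //; rewrite eqxx.
- by exists R => //; rewrite eqxx orbT.
- by left; rewrite -e.
- by right; rewrite -e.
Qed.

Lemma free_meets T B : free T B -> meets T B.
Proof. by case/andP. Qed.

Lemma free_column T h h' j : free T (h, j) -> h' != h -> meets T (h', j) = false.
Proof. by move=> /andP[_ /forallP/(_ h')/implyP /= H] /H /negPf. Qed.

Lemma not_free T h j : meets T (h, j) -> ~~ free T (h, j) ->
  exists2 h', h' != h & meets T (h', j).
Proof.
rewrite /free => ->; rewrite andTb => /forallPn[h']; rewrite negb_imply negbK /= => /andP[].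
by exists h'.
Qed.

Lemma in_bender_knuth T B t : (t \in bender_knuth T B) =
  if free T B && ((t == r) || (t == R)) then tperm r R t \in T (mirror_square T B)
  else t \in T B.
Proof. by rewrite ffunE; case: (free T B) => //=; rewrite inE. Qed.

Lemma free_mirror T B : free T B -> free T (mirror_square T B).
Proof.
case: B => h j; set C := [set k | free T (h, k)] => fr.
by have := @mirror_in _ C j; rewrite !inE /mirror_square /= -/C => ->.
Qed.

Lemma mirror_squareK T B : free T B -> mirror_square T (mirror_square T B) = B.
Proof.
by case: B => h j fr; rewrite /mirror_square /= mirrorK ?inE.
Qed.

Lemma meets_bender_knuth T B : meets (bender_knuth T) B = meets T B.
Proof.
rewrite {1}/meets !in_bender_knuth !eqxx orbT !andbT tpermL tpermR.
case: ifP => // fr; rewrite (free_meets fr) orbC.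
exact: free_meets (free_mirror fr).
Qed.

Lemma free_bender_knuth T B : free (bender_knuth T) B = free T B.
Proof.
rewrite /free meets_bender_knuth; congr (_ && _); apply: eq_forallb => h.
by rewrite meets_bender_knuth.
Qed.

Lemma mirror_bender_knuth T B : mirror_square (bender_knuth T) B = mirror_square T B.
Proof.
rewrite /mirror_square; congr (_, mirror _ _); apply/setP => k.
by rewrite !inE free_bender_knuth.
Qed.

Lemma bender_knuthK : involutive bender_knuth.
Proof.
move=> T; apply/ffunP => B; apply/setP => t; rewrite in_bender_knuth free_bender_knuth.
case: ifP => [/andP[fr tr]|nf]; last by rewrite in_bender_knuth nf.
rewrite mirror_bender_knuth in_bender_knuth free_mirror //= mirror_squareK // tpermK.
by case/orP: tr => /eqP ->; rewrite ?tpermL ?tpermR eqxx ?orbT.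
Qed.

Lemma in_free_bender_knuth T B : free T B ->
  ((r \in bender_knuth T B) = (R \in T (mirror_square T B))) *
  ((R \in bender_knuth T B) = (r \in T (mirror_square T B))).
Proof. by move=> fr; rewrite !in_bender_knuth fr !eqxx orbT tpermL tpermR. Qed.

Section OneTableau.
Variable T : filling n.
Hypothesis Tw : T \in SVRT w (flag0 n).

(** In a column with two squares that meet {r, R}, the upper one contains r and
    the lower one R. *)
Lemma not_free_low h j : r \in T (h, j) -> ~~ free T (h, j) ->
  exists2 h' : 'I_n, (h < h')%N & R \in T (h', j).
Proof.
have [S Rw Cl F] := SVRTP _ _ Tw.
move=> rT nf; have [h' ne] := not_free (T := T) (h := h) (j := j) ltac:(by rewrite /meets rT) nf.
case/meetsP => c cT cr; exists h'.
  rewrite ltn_neqAle (inj_eq val_inj) eq_sym ne leqNgt; apply/negP => lt.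
  by have := Cl _ _ _ _ _ lt cT rT; case/orP: cr => /eqP ->; lia.
case/orP: cr => /eqP e; subst c => //.
case: (ltngtP h h') => [lt|lt|/val_inj e]; last by rewrite e eqxx in ne.
  by have := Cl _ _ _ _ _ lt rT cT; rewrite ltnn.
by have := Cl _ _ _ _ _ lt cT rT; rewrite ltnn.
Qed.

Lemma not_free_high h j : R \in T (h, j) -> ~~ free T (h, j) ->
  exists2 h' : 'I_n, (h' < h)%N & r \in T (h', j).
Proof.
have [S Rw Cl F] := SVRTP _ _ Tw.
move=> RT nf; have [h' ne] := not_free (T := T) (h := h) (j := j) ltac:(by rewrite /meets RT orbT) nf.
case/meetsP => c cT cr; exists h'.
  rewrite ltn_neqAle (inj_eq val_inj) ne leqNgt; apply/negP => lt.
  by have := Cl _ _ _ _ _ lt RT cT; case/orP: cr => /eqP ->; lia.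
case/orP: cr => /eqP e; subst c => //.
case: (ltngtP h h') => [lt|lt|/val_inj e]; last by rewrite e eqxx in ne.
  by have := Cl _ _ _ _ _ lt RT cT; rewrite ltnn.
by have := Cl _ _ _ _ _ lt cT RT; rewrite ltnn.
Qed.

(** If a locked r stood in column k < j, then the square below (h, j) in the row
    of the partner R of that r would be in the diagram by [rothe_row_below], and
    its entries would be squeezed to R, contradicting that (h, j) is free. *)
Lemma locked_low_right h j k : free T (h, j) -> r \in T (h, k) -> ~~ free T (h, k) ->
  (j < k)%N.
Proof.
have [S Rw Cl F] := SVRTP _ _ Tw.
move=> fj rT nk; rewrite ltnNge leq_eqVlt; apply/negP => /orP[/eqP/val_inj e|kj].
  by rewrite e fj in nk.
have [h' hh' RT] := not_free_low rT nk.
have [c cT cr] := meetsP _ _ (free_meets fj).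
have d : (h, j) \in rothe_diagram w by rewrite -S; apply/set0Pn; exists c.
have := rothe_row_below Tw hh' rT RT kj d; rewrite -S => /set0Pn[t tT].
have le1 := Rw _ _ _ _ _ kj cT rT; have le2 := Rw _ _ _ _ _ kj tT RT.
have lt := Cl _ _ _ _ _ hh' cT tT.
have et : t = R by apply: val_inj => /=; case/orP: cr le1 lt => /eqP ->; lia.
have := free_column (h' := h') fj; rewrite /meets -et tT orbT.
by rewrite -(inj_eq val_inj) gtn_eqF // => /(_ isT).
Qed.

(** With (h', k) and (h, j), where h' < h and j < k, a Rothe diagram contains
    (h', j). If j were left of a locked R, this square above (h, j) in the row of
    the partner r would be squeezed to r. *)
Lemma locked_high_left h j k : free T (h, j) -> R \in T (h, k) -> ~~ free T (h, k) ->
  (k < j)%N.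
Proof.
have [S Rw Cl F] := SVRTP _ _ Tw.
move=> fj RT nk; rewrite ltnNge leq_eqVlt; apply/negP => /orP[/eqP/val_inj e|jk].
  by rewrite -e fj in nk.
have [h' h'h rT] := not_free_high RT nk.
have [c cT cr] := meetsP _ _ (free_meets fj).
have d : (h', k) \in rothe_diagram w by rewrite -S; apply/set0Pn; exists r.
have d' : (h, j) \in rothe_diagram w by rewrite -S; apply/set0Pn; exists c.
have : (h', j) \in rothe_diagram w.
  move: d d'; rewrite !in_rothe => /andP[k' _] /andP[_ hj].
  by rewrite (ltn_trans jk k') (ltn_trans h'h hj).
rewrite -S => /set0Pn[t tT].
have le1 := Rw _ _ _ _ _ jk RT cT; have le2 := Rw _ _ _ _ _ jk rT tT.
have lt := Cl _ _ _ _ _ h'h tT cT.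
have et : t = r by apply: val_inj => /=; case/orP: cr le1 lt => /eqP ->; lia.
have := free_column (h' := h') fj; rewrite /meets -et tT.
by rewrite -(inj_eq val_inj) ltn_eqF // => /(_ isT).
Qed.

(** A free square may receive the entry R, so the flag must allow it. In row r
    there is no free square, because the ascent puts the square below each square
    of row r into the diagram, where its entry is forced to be R. *)
Lemma free_flag h j : free T (h, j) -> (R <= h)%N.
Proof.
have [S Rw Cl F] := SVRTP _ _ Tw.
move=> fj; have [c cT cr] := meetsP _ _ (free_meets fj).
have ch := F _ _ _ cT.
have : (r <= h)%N by case/orP: cr ch => /eqP ->; lia.
rewrite leq_eqVlt => /orP[/eqP/val_inj e|]; last by rewrite Rr.
subst h; have ec : c = r by case/orP: cr ch => /eqP -> //; lia.
subst c; have : (r, j) \in rothe_diagram w by rewrite -S; apply/set0Pn; exists r.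
rewrite in_rothe => /andP[jr rj].
have nR : (w^-1)%g j != R.
  by move: jr; apply: contraTneq => e; rewrite -leqNgt -[j](permKV w) e ltnW.
have : (R, j) \in rothe_diagram w.
  by rewrite in_rothe (ltn_trans jr asc) /= ltn_neqAle eq_sym nR /= Rr.
rewrite -S => /set0Pn[t tT].
have lt := Cl r R j r t; rewrite Rr in lt; have {}lt := lt (ltnSn _) cT tT.
have et : t = R by apply: val_inj => /=; have := F _ _ _ tT; lia.
rewrite et in tT; have := free_column (h' := R) fj; rewrite /meets tT orbT.
by rewrite -(inj_eq val_inj) /= Rr gtn_eqF // => /(_ isT).
Qed.

(** Two free squares of a row keep their order by the reversal; a free square
    and a locked one satisfy the row condition whatever the free one contains,
    because locked r's are on its right and locked R's on its left. Columns are
    unaffected, a free square being alone in its column to meet {r, R}. *)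
Lemma bender_knuth_SVRT : bender_knuth T \in SVRT w (flag0 n).
Proof.
have [S Rw Cl F] := SVRTP _ _ Tw.
have meets_r B c : c \in T B -> (c == r) || (c == R) -> meets T B.
  by move=> cT cr; apply/meetsP; exists c.
apply/SVRTP; split.
- move=> i j; rewrite -S; have := meets_bender_knuth T (i, j).
  have [fr|nf] := boolP (free T (i, j)); last by rewrite ffunE (negPf nf).
  have mT := free_meets fr; rewrite mT => /meetsP[c cT _].
  have [c' c'T _] := meetsP _ _ mT.
  by transitivity true; [apply/set0Pn; exists c | apply/esym/set0Pn; exists c'].
- move=> h j k s t jk; rewrite !in_bender_knuth.
  case: ifP => [/andP[fk sr]|nk]; case: ifP => [/andP[fj tr]|nj] sT tT.
  + have jC : j \in [set l | free T (h, l)] by rewrite inE.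
    have kC : k \in [set l | free T (h, l)] by rewrite inE.
    have := Rw _ _ _ _ _ (mirror_lt jC kC jk) tT sT.
    case/orP: sr => /eqP ->; case/orP: tr => /eqP ->;
      by rewrite ?tpermL ?tpermR ?leqnn // Rr ?leqnSn // ltnn.
  + have [c cT cr] := meetsP _ _ (free_meets fk).
    have le := Rw _ _ _ _ _ jk cT tT.
    have [tr|tr] := boolP ((t == r) || (t == R)); last by apply/ltnW/(pair_below cr sr tr le).
    case/orP: tr => /eqP e; subst t; last by case/andP: (pair_bounds sr).
    rewrite eqxx andbT in nj.
    by have := locked_low_right fk tT (negbT nj); rewrite ltnNge (ltnW jk).
  + have [c cT cr] := meetsP _ _ (free_meets fj).
    have le := Rw _ _ _ _ _ jk sT cT.
    have [sr|sr] := boolP ((s == r) || (s == R)); last by apply/ltnW/(pair_above cr tr sr le).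
    case/orP: sr => /eqP e; subst s; first by case/andP: (pair_bounds tr).
    rewrite eqxx orbT andbT in nk.
    by have := locked_high_left fj sT (negbT nk); rewrite ltnNge (ltnW jk).
  + exact: Rw jk sT tT.
- move=> i h j s t ih; rewrite !in_bender_knuth.
  have ne : h != i by rewrite -(inj_eq val_inj) /= gtn_eqF.
  have ne' : i != h by rewrite eq_sym.
  case: ifP => [/andP[fi sr]|ni]; case: ifP => [/andP[fh tr]|nh] sT tT.
  + by have := free_column fi ne; rewrite free_meets.
  + have [c cT cr] := meetsP _ _ (free_meets fi).
    have lt := Cl _ _ _ _ _ ih cT tT.
    have [tr|tr] := boolP ((t == r) || (t == R)); last exact: pair_below cr sr tr (ltnW lt).
    by have := free_column fi ne; rewrite (meets_r _ _ tT tr).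
  + have [c cT cr] := meetsP _ _ (free_meets fh).
    have lt := Cl _ _ _ _ _ ih sT cT.
    have [sr|sr] := boolP ((s == r) || (s == R)); last exact: pair_above cr tr sr (ltnW lt).
    by have := free_column fh ne'; rewrite (meets_r _ _ sT sr).
  + exact: Cl ih sT tT.
- move=> i j t; rewrite in_bender_knuth; case: ifP => [/andP[fr tr] _|_]; last exact: F.
  by case/andP: (pair_bounds tr) => _ /leq_trans -> //; exact: free_flag fr.
Qed.

(** On free squares this is the exchange along the mirror; the remaining r's and
    R's come in pairs, one pair for each column that has both. *)
Lemma occurrences_low_bender_knuth :
  occurrences (bender_knuth T) r = occurrences T R.
Proof.
have [S Rw Cl F] := SVRTP _ _ Tw.
pose Fr : {set 'I_n * 'I_n} := [set B | free T B].
rewrite /occurrences -(cardsID Fr) -[RHS](cardsID Fr); congr (_ + _)%N.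
  rewrite -[RHS](card_in_imset (f := mirror_square T)); last first.
    move=> B B'; rewrite !inE => /andP[_ f1] /andP[_ f2] e.
    by rewrite -(mirror_squareK f1) e mirror_squareK.
  congr #|pred_of_set _|; apply/setP => B; rewrite !inE; apply/andP/imsetP.
    move=> [rT fr]; exists (mirror_square T B); last by rewrite mirror_squareK.
    by rewrite !inE free_mirror // andbT -(in_free_bender_knuth fr).1.
  case=> B'; rewrite !inE => /andP[RT fr] ->; rewrite free_mirror //; split => //.
  by rewrite (in_free_bender_knuth (free_mirror fr)).1 mirror_squareK.
have col_inj t : {in [set B | t \in T B] &, injective (fun B => B.2)}.
  move=> [h j] [h' j']; rewrite !inE /= => tT tT' e; subst j'.
  congr (_, _); case: (ltngtP h h') => [lt|lt|/val_inj //].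
    by have := Cl _ _ _ _ _ lt tT tT'; rewrite ltnn.
  by have := Cl _ _ _ _ _ lt tT' tT; rewrite ltnn.
have -> : [set B | r \in bender_knuth T B] :\: Fr = [set B | r \in T B] :\: Fr.
  apply/setP => B; rewrite !inE in_bender_knuth.
  by have [] := boolP (free T B).
have sub t : {in [set B | t \in T B] :\: Fr &, injective (fun B => B.2)}.
  by move=> B B' /setDP[B1 _] /setDP[B2 _]; apply: (col_inj t).
rewrite -(card_in_imset (sub r)) -(card_in_imset (sub R)).
congr #|pred_of_set _|; apply/setP => j; apply/imsetP/imsetP => -[[h j']];
  rewrite !inE /= => /andP[nf tT] e; subst j'.
  have [h' lt RT] := not_free_low tT nf; exists (h', j) => //; rewrite !inE RT andbT.
  apply/negP => fr; have := free_column (h' := h) fr; rewrite /meets tT.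
  by rewrite -(inj_eq val_inj) /= ltn_eqF // => /(_ isT).
have [h' lt RT] := not_free_high tT nf; exists (h', j) => //; rewrite !inE RT andbT.
apply/negP => fr; have := free_column (h' := h) fr; rewrite /meets tT orbT.
by rewrite -(inj_eq val_inj) /= gtn_eqF // => /(_ isT).
Qed.

End OneTableau.

Lemma occurrences_bender_knuth T t : T \in SVRT w (flag0 n) ->
  occurrences (bender_knuth T) t = occurrences T (tperm r R t).
Proof.
move=> Tw; case: tpermP => [->|->|/eqP n1 /eqP n2].
- exact: occurrences_low_bender_knuth.
- by rewrite -{2}[T]bender_knuthK occurrences_low_bender_knuth // bender_knuth_SVRT.
- rewrite /occurrences; congr #|pred_of_set _|; apply/setP => B; rewrite !inE in_bender_knuth.
  by rewrite (negPf n1) (negPf n2) andbF.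
Qed.

Lemma weight_bender_knuth T : T \in SVRT w (flag0 n) ->
  weight w (bender_knuth T) = msym (tperm r R) (weight w T).
Proof.
move=> Tw; rewrite /weight msymM rmorphXn rmorphN1 /=; congr (_ * _).
rewrite rmorph_prod /= [RHS](reindex_inj (@perm_inj _ (tperm r R))) /=.
apply: eq_bigr => t _.
by rewrite occurrences_bender_knuth // rmorphXn rmorphN /= msym_var tpermK.
Qed.

Lemma msym_sum_SVRT (P Q : pred (filling n)) :
  {in SVRT w (flag0 n), forall T, Q (bender_knuth T) = P T} ->
  msym (tperm r R) (\sum_(T in SVRT w (flag0 n) | P T) weight w T) =
  \sum_(T in SVRT w (flag0 n) | Q T) weight w T.
Proof.
move=> PQ; rewrite [RHS](reindex_inj (inv_inj bender_knuthK)) /= raddf_sum /=.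
have st T : (bender_knuth T \in SVRT w (flag0 n)) = (T \in SVRT w (flag0 n)).
  by apply/idP/idP => [/bender_knuth_SVRT|/bender_knuth_SVRT //]; rewrite bender_knuthK.
apply: eq_big => [T|T /andP[Tw _]]; last by rewrite weight_bender_knuth.
by rewrite st; case: (boolP (T \in _)) => // /PQ ->.
Qed.

End BenderKnuth.

(** * The recursion of the tableau sums at the first ascent *)

Lemma weight_add_entry n (v w : 'S_n) (U T : filling n) (r : 'I_n) :
  (forall t, occurrences U t = (occurrences T t + (t == r))%N) ->
  weight v U = - (-1) ^+ (perm_length v + perm_length w) * 'X_r * weight w T.
Proof.
move=> occ; rewrite /weight.
have -> : \prod_t (- 'X_t) ^+ occurrences U t =
    - 'X_r * \prod_t (- 'X_t) ^+ occurrences T t :> {mpoly int[n]}.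
  rewrite (bigD1 r) //= [in RHS](bigD1 r) //= occ eqxx addn1 exprS -mulrA; congr (_ * (_ * _)).
  by apply: eq_bigr => t /negPf nt; rewrite occ nt addn0.
have e1 : ((-1) ^+ perm_length w) * ((-1) ^+ perm_length w) = 1 :> {mpoly int[n]}.
  by rewrite -exprD addnn -signr_odd odd_double.
rewrite exprD; move: e1.
move: (\prod_t _) ((-1) ^+ perm_length w) ((-1) ^+ perm_length v) => p f e e1.
transitivity (e * (- 'X_r * p) * (f * f)); first by rewrite e1 mulr1.
by ring.
Qed.

Lemma val_tperm n (r R p : 'I_n) : R = r.+1 :> nat -> tperm r R p =
  (if p == r :> nat then r.+1 else if p == r.+1 :> nat then r : nat else p) :> nat.
Proof.
move=> Rr; rewrite -Rr; case: tpermP => [->|->|/eqP n1 /eqP n2]; rewrite ?eqxx //.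
  by rewrite [X in if X then _ else _]gtn_eqF // Rr.
by rewrite (inj_eq val_inj) (negPf n1) (inj_eq val_inj) (negPf n2).
Qed.

Lemma tperm_lt n (r R p q : 'I_n) : R = r.+1 :> nat ->
  (p < q)%N -> (p, q) != (r, R) -> (tperm r R p < tperm r R q)%N.
Proof.
move=> Rr; rewrite xpair_eqE -!(inj_eq val_inj) /= !(val_tperm _ Rr) Rr.
move: (nat_of_ord p) (nat_of_ord q) (nat_of_ord r) => x y z.
case: (x =P z) => ?; case: (x =P z.+1) => ?; case: (y =P z) => ?;
  by case: (y =P z.+1) => ?; lia.
Qed.

Section FirstAscent.
Variables (n : nat) (w : 'S_n) (r R : 'I_n).
Hypotheses (Rr : R = r.+1 :> nat) (asc : (w r < w R)%N).
Hypothesis (prefix : forall p : 'I_n, (p < r)%N -> (w r < w p)%N).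
Implicit Types (T U : filling n) (B : 'I_n * 'I_n) (h j k t : 'I_n).

(** The occurrences of R to the left of column w r are frozen; this records
    whether row R has another one. *)
Definition has_R T : bool := [exists j : 'I_n, (w r < j)%N && (R \in T (R, j))].

Definition has_rR T : bool := [exists j : 'I_n, (r \in T (R, j)) && (R \in T (R, j))].

(** All values smaller than w r come after position R. *)
Lemma prefix_full h j : (j < w r)%N -> (h <= R)%N -> (h, j) \in rothe_diagram w.
Proof.
move=> jr hR; rewrite in_rothe.
have wj : w ((w^-1)%g j) = j by rewrite permKV.
have Rj : (R < (w^-1)%g j)%N.
  rewrite ltnNge; apply/negP; rewrite leq_eqVlt => /orP[/eqP/val_inj e|].
    by move: asc; rewrite -e wj; lia.
  rewrite Rr ltnS leq_eqVlt => /orP[/eqP/val_inj e|/prefix].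
    by move: jr; rewrite -e wj; lia.
  by rewrite wj; lia.
rewrite (leq_ltn_trans hR Rj) andbT.
move: hR; rewrite leq_eqVlt => /orP[/eqP/val_inj ->|]; first exact: ltn_trans asc.
rewrite Rr ltnS leq_eqVlt => /orP[/eqP/val_inj -> //|/prefix].
exact: ltn_trans.
Qed.

Lemma rothe_row_r j : (r, j) \in rothe_diagram w -> (j < w r)%N.
Proof. by rewrite in_rothe => /andP[]. Qed.

Lemma rothe_column_wr h : (h, w r) \in rothe_diagram w -> (h < r)%N.
Proof. by rewrite in_rothe permK => /andP[]. Qed.

Lemma nonempty_rothe T h j t : T \in SVRT w (flag0 n) -> t \in T (h, j) ->
  (h, j) \in rothe_diagram w.
Proof. by case/SVRTP => S _ _ _ tT; rewrite -S; apply/set0Pn; exists t. Qed.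

Lemma frozen_prefix T h j t : T \in SVRT w (flag0 n) ->
  (j < w r)%N -> (h <= R)%N -> t \in T (h, j) -> t = h.
Proof.
move=> Tw jr hR; apply: frozen Tw _ => p ph; apply: prefix_full => //.
exact: leq_trans hR.
Qed.

Lemma low_column T j : T \in SVRT w (flag0 n) -> r \in T (R, j) -> (w r < j)%N.
Proof.
move=> Tw rT; case: (ltngtP (w r) j) => // [jr|/val_inj e].
  by have := frozen_prefix Tw jr (leqnn R) rT => e; move: Rr; rewrite -e; lia.
have := nonempty_rothe Tw rT; rewrite -e => /rothe_column_wr; lia.
Qed.

Lemma has_rR_has_R T : T \in SVRT w (flag0 n) -> has_rR T -> has_R T.
Proof.
move=> Tw /existsP[j /andP[rT RT]]; apply/existsP; exists j.
by rewrite RT (low_column Tw rT).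
Qed.

Definition last_R T j : bool :=
  [&& (w r < j)%N, R \in T (R, j) & [forall k : 'I_n, (j < k)%N ==> (R \notin T (R, k))]].

(** There is at most one column j with [last_R T j], so at most one square
    changes. *)
Definition add_r T : filling n :=
  [ffun B => if (B.1 == R) && last_R T B.2 then r |: T B else T B].

Definition remove_r T : filling n :=
  [ffun B => if (B.1 == R) && (R \in T B) then T B :\ r else T B].

Lemma in_add_r T h j t :
  (t \in add_r T (h, j)) = (t \in T (h, j)) || [&& t == r, h == R & last_R T j].
Proof.
rewrite ffunE /=; case: (h == R) => //=; last by rewrite andbF orbF.
by case: (last_R T j); rewrite ?andbF ?orbF // andbT !inE orbC.
Qed.

Lemma in_remove_r T h j t :
  (t \in remove_r T (h, j)) = (t \in T (h, j)) && ~~ [&& t == r, h == R & R \in T (h, j)].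
Proof.
rewrite ffunE /=; case: (h == R) => //=; last by rewrite andbF andbT.
by case: (R \in T (h, j)); rewrite ?andbF ?andbT // !inE andbC.
Qed.

Lemma r_neq_R : (r == R) = false.
Proof. by rewrite -(inj_eq val_inj) /= Rr ltn_eqF. Qed.

Lemma last_R_exists T : has_R T -> exists j, last_R T j.
Proof.
case/existsP => j0 Pj0.
case: (@arg_maxnP _ j0 (fun j : 'I_n => (w r < j)%N && (R \in T (R, j))) val Pj0).
move=> j /andP[j1 j2] max; exists j; rewrite /last_R j1 j2; apply/forallP => k.
apply/implyP => jk; apply/negP => RT.
by have := max k; rewrite RT (ltn_trans j1 jk) => /(_ isT) /=; rewrite leqNgt jk.
Qed.

Lemma last_R_uniq T j k : last_R T j -> last_R T k -> j = k.
Proof.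
move=> /and3P[_ Rj /forallP Lj] /and3P[_ Rk /forallP Lk].
case: (ltngtP j k) => [jk|kj|/val_inj //].
  by have := Lj k; rewrite jk Rk.
by have := Lk j; rewrite kj Rj.
Qed.

(** The square of the rightmost R can take r in: what lies to its right is at
    most r, and row r has no square above it, so what lies above is less than
    r. *)
Lemma add_r_SVRT T : T \in SVRT w (flag0 n) -> add_r T \in SVRT w (flag0 n).
Proof.
move=> Tw; have [S Rw Cl F] := SVRTP _ _ Tw.
have sub h j t : t \in T (h, j) -> t \in add_r T (h, j) by rewrite in_add_r => ->.
apply/SVRTP; split.
- move=> h j; rewrite -S; apply/idP/idP => /set0Pn[t]; last first.
    by move=> /sub tT; apply/set0Pn; exists t.
  rewrite in_add_r => /orP[tT|/and3P[_ /eqP -> /and3P[_ RT _]]]; apply/set0Pn.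
    by exists t.
  by exists R.
- move=> h j k s t jk; rewrite !in_add_r.
  move=> /orP[sT|/and3P[/eqP -> /eqP eh /and3P[_ RT _]]].
    move=> /orP[tT|/and3P[/eqP -> /eqP eh /and3P[_ RT /forallP/(_ k)]]].
      exact: Rw jk sT tT.
    rewrite jk /= => nRT; have := Rw R j k s R jk; rewrite -{1}eh => /(_ sT RT).
    rewrite leq_eqVlt Rr ltnS => /orP[/eqP e|//].
    by have es : s = R; [apply: val_inj; rewrite /= Rr e | rewrite es eh in sT; rewrite sT in nRT].
  move=> /orP[tT|/and3P[/eqP -> //]].
  have := Rw R j k R t jk RT; rewrite -{1}eh => /(_ tT); lia.
- move=> i h j s t ih; rewrite !in_add_r.
  move=> /orP[sT|/and3P[/eqP -> /eqP ei /and3P[_ RT _]]].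
    move=> /orP[tT|/and3P[/eqP -> /eqP eh /and3P[wj RT _]]].
      exact: Cl ih sT tT.
    subst h; have := Cl _ _ _ _ _ ih sT RT; rewrite Rr ltnS leq_eqVlt.
    case/orP=> [/eqP/val_inj es|//]; subst s; have := F _ _ _ sT.
    rewrite leq_eqVlt => /orP[/eqP/val_inj ei|]; last by lia.
    by subst i; have := rothe_row_r (nonempty_rothe Tw sT); lia.
  subst i; move=> /orP[tT|/and3P[_ /eqP eh _]]; last by rewrite eh ltnn in ih.
  have := Cl _ _ _ _ _ ih RT tT; lia.
- move=> i j t; rewrite in_add_r => /orP[|/and3P[/eqP -> /eqP -> _]]; first exact: F.
  by rewrite Rr.
Qed.

Lemma remove_r_SVRT T : T \in SVRT w (flag0 n) -> remove_r T \in SVRT w (flag0 n).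
Proof.
move=> Tw; have [S Rw Cl F] := SVRTP _ _ Tw.
have sub h j t : t \in remove_r T (h, j) -> t \in T (h, j).
  by rewrite in_remove_r => /andP[].
apply/SVRTP; split.
- move=> h j; rewrite -S; apply/idP/idP => /set0Pn[t tT]; apply/set0Pn.
    by exists t; apply: sub.
  have [/and3P[_ /eqP eh RT]|nr] := boolP [&& t == r, h == R & R \in T (h, j)].
    by exists R; rewrite in_remove_r RT eq_sym r_neq_R.
  by exists t; rewrite in_remove_r tT.
- by move=> h j k s t jk /sub sT /sub; apply: Rw sT.
- by move=> i h j s t ih /sub sT /sub; apply: Cl sT.
- by move=> i j t /sub; apply: F.
Qed.

Lemma has_rR_add_r T : has_R T -> has_rR (add_r T).
Proof.
move=> /last_R_exists[j lj]; apply/existsP; exists j; rewrite !in_add_r !eqxx lj orbT.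
by case/and3P: lj => _ ->.
Qed.

Lemma has_rR_remove_r T : ~~ has_rR (remove_r T).
Proof.
apply/existsPn => j; rewrite !in_remove_r !eqxx [R == r]eq_sym r_neq_R andbT /=.
by case: (R \in T (R, j)); rewrite ?andbF.
Qed.

Lemma has_R_remove_r T : T \in SVRT w (flag0 n) -> has_rR T -> has_R (remove_r T).
Proof.
move=> Tw /(has_rR_has_R Tw)/existsP[j /andP[wj RT]]; apply/existsP; exists j.
by rewrite wj in_remove_r RT [R == r]eq_sym r_neq_R.
Qed.

Lemma add_rK T : ~~ has_rR T -> remove_r (add_r T) = T.
Proof.
move=> /existsPn nrR; apply/ffunP => -[h j]; apply/setP => t.
rewrite in_remove_r !in_add_r [R == r]eq_sym r_neq_R orbF.
have [->|] := eqVneq t r; last by rewrite /= orbF andbT.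
have [->|] := eqVneq h R; last by rewrite /= orbF andbT.
rewrite /=; have := nrR j; rewrite /last_R.
by case: (R \in T (R, j)); rewrite ?andbT ?andbF ?orbF //= => /negPf ->.
Qed.

(** The square of row R that contains both r and R is the rightmost one with
    an R, since r bounds the entries to its right; so adding r restores it. *)
Lemma remove_rK T : T \in SVRT w (flag0 n) -> has_rR T -> add_r (remove_r T) = T.
Proof.
move=> Tw /existsP[j0 /andP[r0 R0]]; have [S Rw Cl F] := SVRTP _ _ Tw.
have RE k : (R \in remove_r T (R, k)) = (R \in T (R, k)).
  by rewrite in_remove_r [R == r]eq_sym r_neq_R andbT.
have l0 : last_R (remove_r T) j0.
  rewrite /last_R RE R0 (low_column Tw r0) /=; apply/forallP => k; apply/implyP => jk.
  by rewrite RE; apply/negP => RT; have := Rw _ _ _ _ _ jk RT r0; lia.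
apply/ffunP => -[h j]; apply/setP => t; rewrite in_add_r in_remove_r.
have [->|] := eqVneq t r; last by rewrite /= orbF andbT.
have [->|] := eqVneq h R; last by rewrite /= orbF andbT.
rewrite /=; have [RT|nRT] := boolP (R \in T (R, j)); last first.
  by rewrite andbT /last_R RE (negPf nRT) andbF orbF.
rewrite andbF /=; apply/idP/idP => [lj|rT]; first by rewrite (last_R_uniq lj l0).
suff -> : j = j0 by [].
case: (ltngtP j j0) => [lt|lt|/val_inj //].
  by have := Rw _ _ _ _ _ lt R0 rT; lia.
by have := Rw _ _ _ _ _ lt RT r0; lia.
Qed.

Lemma occurrences_add_r T t : ~~ has_rR T -> has_R T ->
  occurrences (add_r T) t = (occurrences T t + (t == r))%N.
Proof.
move=> /existsPn nrR /last_R_exists[j lj]; rewrite /occurrences.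
have [->|ne] := eqVneq t r; last first.
  rewrite addn0; congr #|pred_of_set _|; apply/setP => -[h k].
  by rewrite !inE in_add_r (negPf ne) orbF.
have -> : [set B | r \in add_r T B] = (R, j) |: [set B | r \in T B].
  apply/setP => -[h k]; rewrite !inE in_add_r eqxx xpair_eqE orbC /=; congr (_ || _).
  congr (_ && _); apply/idP/eqP => [lk|-> //]; exact: last_R_uniq lk lj.
rewrite cardsU1 inE addnC; congr (_ + _)%N.
by have := nrR j; case/and3P: lj => _ -> _; rewrite andbT => ->.
Qed.

(** Adding the entry r multiplies the weight by - x_r. *)
Lemma sum_has_rR :
  \sum_(T in SVRT w (flag0 n) | has_rR T) weight w T =
  - 'X_r * \sum_(T in SVRT w (flag0 n) | ~~ has_rR T && has_R T) weight w T.
Proof.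
rewrite (reindex_onto add_r remove_r) /=; last by move=> T /andP[Tw rR]; exact: remove_rK.
rewrite big_distrr /=; apply: eq_big => [T|T].
  apply/andP/andP => [[/andP[Tw rR] /eqP e]|[Tw /andP[nrR hR]]].
    rewrite -e; split; first exact: remove_r_SVRT.
    by rewrite has_rR_remove_r has_R_remove_r.
  by rewrite add_r_SVRT // has_rR_add_r // add_rK.
case/andP=> [/andP[Tw rR] /eqP e].
have nrR : ~~ has_rR T by rewrite -e has_rR_remove_r.
have hR : has_R T by rewrite -e has_R_remove_r.
rewrite (weight_add_entry w w (fun t => occurrences_add_r t nrR hR)).
by rewrite addnn -signr_odd odd_double mulN1r.
Qed.

Local Notation u := (tperm r R * w)%g.
Local Notation s := (tperm r R).

(** The rows r and R are exchanged in the columns beyond w r; apart from the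
    corner (r, w r), this maps the diagram of w s_r to that of w. To the left
    both rows are full. *)
Definition shift B : 'I_n * 'I_n := (if (w r < B.2)%N then s B.1 else B.1, B.2).

Lemma shiftK : involutive shift.
Proof. by move=> [h j]; rewrite /shift /=; case E: (w r < j)%N; rewrite ?tpermK. Qed.

Lemma shift_corner : shift (r, w r) = (r, w r).
Proof. by rewrite /shift /= ltnn. Qed.

Lemma rothe_swap B :
  (B \in rothe_diagram u) = (B == (r, w r)) || (shift B \in rothe_diagram w).
Proof.
case: B => h j; rewrite /shift /= !in_rothe invMg tpermV !permM xpair_eqE.
have wj : w ((w^-1)%g j) = j by rewrite permKV.
case: (ltngtP (w r) j) => [rj|jr|/val_inj e].
- rewrite [j == _](_ : _ = false) ?andbF /=; last by rewrite -(inj_eq val_inj) gtn_eqF.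
  have q_r : (w^-1)%g j != r by apply: contraTneq rj => <-; rewrite wj ltnn.
  have [jh /=|//] := ltnP j (w (s h)).
  have sh_r : s h != r by apply: contraTneq jh => ->; lia.
  have h_R : h != R by apply: contraNneq sh_r => ->; rewrite tpermR.
  move: q_r h_R; rewrite -!(inj_eq val_inj) /= !(val_tperm _ Rr) Rr.
  move: (nat_of_ord _) (nat_of_ord h) (nat_of_ord r) => x y z.
  by case: (x =P z) => ?; case: (x =P z.+1) => ?; case: (y =P z) => ?;
    case: (y =P z.+1) => ?; lia.
- rewrite [j == _](_ : _ = false) ?andbF /=; last by rewrite -(inj_eq val_inj) ltn_eqF.
  have := prefix_full jr (leqnn R); rewrite in_rothe => /andP[_ Rj].
  have sq : s ((w^-1)%g j) = (w^-1)%g j.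
    by rewrite tpermD // -(inj_eq val_inj) /= ltn_eqF // -Rr ltnW.
  rewrite sq; case: (tpermP r R h) => [->|->|//].
    by rewrite jr (ltn_trans jr asc).
  by rewrite jr (ltn_trans jr asc).
- subst j; rewrite permK tpermL eqxx andbT Rr ltnS.
  case: (tpermP r R h) => [->|->|/eqP h1 /eqP h2].
  + by rewrite asc leqnn eqxx.
  + by rewrite ltnn [R == r]eq_sym r_neq_R Rr [(_.+1 < _)%N]ltnNge leqW ?andbF.
  + by rewrite (negPf h1) /= [(h <= r)%N]leq_eqVlt (inj_eq val_inj) (negPf h1).
Qed.

Lemma perm_length_swap : perm_length u = (perm_length w).+1.
Proof.
rewrite -!card_rothe -[X in _ = X.+1](card_imset _ (inv_inj shiftK)).
have -> : rothe_diagram u = (r, w r) |: shift @: rothe_diagram w.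
  apply/setP => B; rewrite rothe_swap in_setU1; congr (_ || _).
  by rewrite -[B in RHS]shiftK (mem_imset _ _ (inv_inj shiftK)).
by rewrite cardsU1 -shift_corner (mem_imset _ _ (inv_inj shiftK)) in_rothe ltnn.
Qed.

Definition lift_tableau T : filling n :=
  [ffun B => if B == (r, w r) then [set r] else T (shift B)].

Definition drop_tableau U : filling n :=
  [ffun B => if B == (r, w r) then set0 else U (shift B)].

Lemma shift_eq_corner B : (shift B == (r, w r)) = (B == (r, w r)).
Proof. by rewrite -{1}shift_corner (inj_eq (inv_inj shiftK)). Qed.

Lemma corner_empty T : T \in SVRT w (flag0 n) -> T (r, w r) = set0.
Proof.
by case/SVRTP => S _ _ _; apply/eqP; rewrite -[_ == _]negbK S in_rothe ltnn.
Qed.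

Lemma in_lift T h j t : (t \in lift_tableau T (h, j)) =
  if (h == r) && (j == w r) then t == r
  else t \in T (if (w r < j)%N then s h else h, j).
Proof. by rewrite ffunE xpair_eqE /=; case: ifP => //; rewrite inE. Qed.

Lemma in_drop T h j t : (t \in drop_tableau T (h, j)) =
  ~~ ((h == r) && (j == w r)) && (t \in T (if (w r < j)%N then s h else h, j)).
Proof. by rewrite ffunE xpair_eqE /=; case: ifP => //; rewrite inE. Qed.

(** The entries moved from row R up to row r respect the flag because none of
    them is R; the corner {r} fits between the frozen entries r on its left and the
    entries at most r on its right. *)
Lemma lift_SVRT T : T \in SVRT w (flag0 n) -> ~~ has_R T ->
  lift_tableau T \in SVRT u (flag0 n).
Proof.
move=> Tw /existsPn nR; have [S Rw Cl F] := SVRTP _ _ Tw.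
have no_r j t : (w r < j)%N -> t \in T (r, j) -> False.
  by move=> rj /(nonempty_rothe Tw)/rothe_row_r; lia.
have small j t : (w r < j)%N -> t \in T (R, j) -> (t <= r)%N.
  move=> rj tT; have := F _ _ _ tT; rewrite leq_eqVlt Rr ltnS => /orP[/eqP e|//].
  have et : t = R by apply: val_inj; rewrite /= Rr e.
  by have := nR j; rewrite rj -[X in X \in _]et tT.
have ltR (j k : 'I_n) : (j < k)%N -> (w r < j)%N -> (w r < k)%N.
  by move=> jk rj; apply: ltn_trans jk.
apply/SVRTP; split.
- move=> h j; rewrite rothe_swap -S ffunE; case: ifP => // _.
  by apply/set0Pn; exists r; rewrite inE.
- move=> h j k x y jk; rewrite !in_lift.
  have [->|h_r] := eqVneq h r; rewrite /=.
    have yr : (j < w r)%N -> y \in T (r, j) -> (r <= y)%N.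
      by move=> jr yT; rewrite (frozen_prefix Tw jr _ yT) // Rr.
    rewrite tpermL; case: (ltngtP (w r) k) => [rk|kr|/val_inj ek].
    + rewrite [k == _](_ : _ = false); last by rewrite -(inj_eq val_inj) gtn_eqF.
      move=> xT; have xr := small _ _ rk xT.
      case: (ltngtP (w r) j) => [rj|jr|/val_inj ej].
      * rewrite [j == _](_ : _ = false); last by rewrite -(inj_eq val_inj) gtn_eqF.
        exact: Rw jk xT.
      * rewrite [j == _](_ : _ = false); last by rewrite -(inj_eq val_inj) ltn_eqF.
        by move=> /(yr jr); apply: leq_trans.
      * by rewrite -ej eqxx => /eqP ->.
    + have jr := ltn_trans jk kr.
      rewrite [k == _](_ : _ = false); last by rewrite -(inj_eq val_inj) ltn_eqF.
      rewrite [j == _](_ : _ = false); last by rewrite -(inj_eq val_inj) ltn_eqF.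
      by rewrite [(w r < j)%N]ltnNge (ltnW jr) /=; apply: Rw jk.
    + subst k; rewrite eqxx => /eqP ->.
      rewrite [j == _](_ : _ = false); last by rewrite -(inj_eq val_inj) ltn_eqF.
      by rewrite ltnNge (ltnW jk) /=; apply: yr.
  have [->|h_R] := eqVneq h R; last first.
    by rewrite tpermD 1?eq_sym // !if_same; apply: Rw jk.
  rewrite tpermR; case: ifP => [rk /(no_r _ _ rk) //|/negbT nrk].
  rewrite ifF; first exact: Rw jk.
  by apply: contraNF nrk; apply: ltR.
- move=> i h j x y ih; rewrite !in_lift.
  case: (ltngtP (w r) j) => [rj|jr|/val_inj ej].
  + rewrite [j == _](_ : _ = false) ?andbF; last by rewrite -(inj_eq val_inj) gtn_eqF.
    have [[-> ->]|ne] := eqVneq (i, h) (r, R); last exact: Cl (tperm_lt Rr ih ne).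
    by rewrite tpermR => _ /(no_r _ _ rj).
  + rewrite [j == _](_ : _ = false) ?andbF; last by rewrite -(inj_eq val_inj) ltn_eqF.
    exact: Cl ih.
  + subst j; rewrite !eqxx !andbT.
    have [ei|ni] := eqVneq i r.
      rewrite [h == r]gtn_eqF //; last by rewrite -ei.
      by move=> _ /(nonempty_rothe Tw)/rothe_column_wr; rewrite -ei; lia.
    move=> xT; have ir := rothe_column_wr (nonempty_rothe Tw xT).
    case: eqP => [_ /eqP ->|_]; last exact: Cl ih xT.
    exact: leq_ltn_trans (F _ _ _ xT) ir.
- move=> i j t; rewrite in_lift; case: ifP => [/andP[/eqP -> _] /eqP -> //|_].
  case: ifP => [rj|_]; last exact: F.
  by case: tpermP => [->|->|_ _]; [exact: small | move=> /(no_r _ _ rj) | exact: F].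
Qed.

(** In row R of the new tableau, the entries moved down from row r meet those
    to their left, which they do not exceed because the square above each of the
    latter is already at least as large. *)
Lemma drop_SVRT U : U \in SVRT u (flag0 n) ->
  drop_tableau U \in SVRT w (flag0 n) /\ ~~ has_R (drop_tableau U).
Proof.
move=> Uu; have [S Rw Cl F] := SVRTP _ _ Uu.
have dia h j t : t \in U (h, j) -> ((h, j) == (r, w r)) || (shift (h, j) \in rothe_diagram w).
  by move=> tU; rewrite -rothe_swap -S; apply/set0Pn; exists t.
have no_R j t : (w r <= j)%N -> t \in U (R, j) -> False.
  move=> rj /dia; rewrite xpair_eqE [R == r]eq_sym r_neq_R /= /shift /= tpermR.
  move: rj; rewrite leq_eqVlt => /orP[/eqP/val_inj e|rj].
    by rewrite -e ltnn => /rothe_column_wr; lia.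
  by rewrite rj => /rothe_row_r; lia.
have ltR (j k : 'I_n) : (j < k)%N -> (w r < j)%N -> (w r < k)%N.
  by move=> jk rj; apply: ltn_trans jk.
split; last first.
  apply/existsPn => j; rewrite in_drop negb_and; apply/norP => -[].
  rewrite negbK => rj; rewrite rj tpermR [R == r]eq_sym r_neq_R /= negbK => /F.
  lia.
apply/SVRTP; split.
- move=> h j; rewrite ffunE; have [->|ne] := eqVneq (h, j) (r, w r).
    by rewrite eqxx in_rothe ltnn.
  have SB B : (U B != set0) = (B \in rothe_diagram u) by case: B => a b; apply: S.
  by rewrite SB rothe_swap shift_eq_corner (negPf ne) shiftK.
- move=> h j k x y jk; rewrite !in_drop => /andP[nk xU] /andP[nj].
  move: xU; have [e|h_r] := eqVneq h r.
    subst h; rewrite !tpermL; case: ifP => [rk /(no_R _ _ (ltnW rk)) //|/negbT nrk].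
    by rewrite ifF; [exact: Rw jk | apply: contraNF nrk; apply: ltR].
  have [e|h_R] := eqVneq h R; last first.
    by rewrite tpermD 1?eq_sym // !if_same; apply: Rw jk.
  subst h; rewrite !tpermR; case: ifP => [rk xU|/negbT nrk]; last first.
    by rewrite ifF; [exact: Rw jk | apply: contraNF nrk; apply: ltR].
  case: ifP => [rj|/negbT]; first exact: Rw jk xU.
  rewrite -leqNgt leq_eqVlt => /orP[/eqP/val_inj -> /(no_R _ _ (leqnn _)) //|jr yU].
  have : (r, j) \in rothe_diagram u.
    by rewrite rothe_swap /shift /= ltnNge (ltnW jr) /= prefix_full ?orbT // Rr.
  rewrite -S => /set0Pn[t tU]; apply: leq_trans (Rw _ _ _ _ _ jk xU tU) _.
  by apply/ltnW/(Cl r R j t y) => //; rewrite Rr.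
- move=> i h j x y ih; rewrite !in_drop => /andP[_ xU] /andP[_]; move: xU.
  case: ifP => [rj|_]; last exact: Cl ih.
  have [[-> ->]|ne] := eqVneq (i, h) (r, R); last exact: Cl (tperm_lt Rr ih ne).
  by rewrite tpermL => /(no_R _ _ (ltnW rj)).
- move=> i j t; rewrite in_drop => /andP[_]; case: ifP => [rj|_]; last exact: F.
  case: tpermP => [_|-> /F|_ _]; [by move/(no_R _ _ (ltnW rj)) | lia | exact: F].
Qed.

Lemma lift_tableauK T : T \in SVRT w (flag0 n) -> drop_tableau (lift_tableau T) = T.
Proof.
move=> Tw; apply/ffunP => B; rewrite !ffunE shift_eq_corner shiftK.
by case: eqP => // ->; rewrite corner_empty.
Qed.

(** The square (r, w r) is frozen in the diagram of w s_r, so its contents need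
    not be remembered. *)
Lemma drop_tableauK U : U \in SVRT u (flag0 n) -> lift_tableau (drop_tableau U) = U.
Proof.
move=> Uu; apply/ffunP => B; rewrite !ffunE shift_eq_corner shiftK.
case: eqP => // ->; apply/esym/eqP.
have full (p : 'I_n) : (p <= r)%N -> (p, w r) \in rothe_diagram u.
  rewrite rothe_swap leq_eqVlt => /orP[/eqP/val_inj ->|pr]; first by rewrite eqxx.
  by rewrite /shift /= ltnn in_rothe permK prefix ?pr ?orbT.
have [S _ _ _] := SVRTP _ _ Uu.
have froz t : t \in U (r, w r) -> t = r by apply: frozen Uu full.
have : U (r, w r) != set0 by rewrite S full.
case/set0Pn => t tU; apply/eqP/setP => x; rewrite inE; apply/idP/eqP => [/froz //|->].
by rewrite -[X in X \in _](froz t tU).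
Qed.

Lemma occurrences_lift T t : T \in SVRT w (flag0 n) ->
  occurrences (lift_tableau T) t = (occurrences T t + (t == r))%N.
Proof.
move=> Tw; rewrite /occurrences -[in RHS](card_imset _ (inv_inj shiftK)).
have mem B : (B \in shift @: [set C | t \in T C]) = (t \in T (shift B)).
  by rewrite -[B in LHS]shiftK (mem_imset _ _ (inv_inj shiftK)) inE.
have corner : (r, w r) \notin shift @: [set C | t \in T C].
  by rewrite mem shift_corner corner_empty // inE.
have -> : [set B | t \in lift_tableau T B] =
    (if t == r then [set (r, w r)] else set0) :|: shift @: [set C | t \in T C].
  apply/setP => B; rewrite in_setU mem inE ffunE.
  case: (eqVneq B (r, w r)) => [->|ne]; rewrite ?inE.
    rewrite shift_corner corner_empty // inE orbF.
    by case: (t == r); rewrite inE ?eqxx.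
  by case: (t == r); rewrite inE ?(negPf ne).
by case: eqP => _; rewrite ?set0U ?addn0 // cardsU1 corner addnC.
Qed.

Lemma sum_SVRT_swap :
  \sum_(U in SVRT u (flag0 n)) weight u U =
  'X_r * \sum_(T in SVRT w (flag0 n) | ~~ has_R T) weight w T.
Proof.
rewrite (reindex_onto lift_tableau drop_tableau) /=; last exact: drop_tableauK.
rewrite big_distrr /=; apply: eq_big => [T|T].
  apply/andP/andP => [[Uu /eqP <-]|[Tw nR]]; first by have [] := drop_SVRT Uu.
  by rewrite lift_SVRT // lift_tableauK.
case/andP=> Uu /eqP e; have [Tw _] := drop_SVRT Uu; rewrite e in Tw.
rewrite (weight_add_entry u w (fun t => occurrences_lift t Tw)) perm_length_swap.
by rewrite addSn addnn exprS -signr_odd odd_double mulr1 opprK mul1r.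
Qed.

(** A square with both r and R is free, and its mirror receives both. *)
Lemma has_rR_bender_knuth T : T \in SVRT w (flag0 n) ->
  has_rR T -> has_rR (bender_knuth r R T).
Proof.
move=> Tw /existsP[j /andP[rT RT]]; have [S Rw Cl F] := SVRTP _ _ Tw.
have fr : free r R T (R, j).
  rewrite /free /meets rT /=; apply/forallP => h; apply/implyP => ne; apply/norP.
  case: (ltngtP h R) => [lt|lt|/val_inj e]; last by rewrite e eqxx in ne.
    split; apply/negP => hT.
      by have := Cl _ _ _ _ _ lt hT rT; rewrite ltnn.
    by have := Cl _ _ _ _ _ lt hT RT; rewrite ltnn.
  split; apply/negP => hT.
    by have := Cl _ _ _ _ _ lt rT hT; rewrite ltnn.
  by have := Cl _ _ _ _ _ lt RT hT; rewrite ltnn.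
have fr' := free_mirror fr.
apply/existsP; exists (mirror_square r R T (R, j)).2.
have [-> ->] := in_free_bender_knuth fr'.
by rewrite mirror_squareK // rT RT.
Qed.

Hypothesis w_avoids : avoids_1432 w.

(** Let P and Q be the sums over the tableaux without and with a square of row R
    that contains r and R, let A be the sum over the tableaux without [has_R], and
    A' = s A. The two expressions Q = - x_r (P - A) = - x_R (P - A') give x_r P - x_R P = x_r A - x_R A', and the
    identity becomes linear in A and A'. *)
Lemma sum_SVRT_isobaric :
  (\sum_(T in SVRT w (flag0 n)) weight w T) * ('X_r - 'X_R) =
  (1 - 'X_R) * (\sum_(U in SVRT u (flag0 n)) weight u U) -
  (1 - 'X_r) * msym s (\sum_(U in SVRT u (flag0 n)) weight u U).
Proof.
rewrite sum_SVRT_swap msymM msym_var tpermL (bigID has_rR) /=.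
have rR_BK : {in SVRT w (flag0 n), forall T, has_rR (bender_knuth r R T) = has_rR T}.
  move=> T Tw; apply/idP/idP; last exact: has_rR_bender_knuth.
  by move/(has_rR_bender_knuth (bender_knuth_SVRT w_avoids Rr asc Tw)); rewrite bender_knuthK.
have symQ := msym_sum_SVRT w_avoids Rr asc rR_BK.
have symP : msym s (\sum_(T in SVRT w (flag0 n) | ~~ has_rR T) weight w T) =
    \sum_(T in SVRT w (flag0 n) | ~~ has_rR T) weight w T.
  by apply: (msym_sum_SVRT w_avoids Rr asc) => T Tw; rewrite rR_BK.
have eQ := sum_has_rR.
have ePA : \sum_(T in SVRT w (flag0 n) | ~~ has_rR T && has_R T) weight w T =
    \sum_(T in SVRT w (flag0 n) | ~~ has_rR T) weight w T -
    \sum_(T in SVRT w (flag0 n) | ~~ has_R T) weight w T.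
  rewrite [X in _ = X - _](bigID has_R) /= [X in _ = _ + X - _](_ : _ =
    \sum_(T in SVRT w (flag0 n) | ~~ has_R T) weight w T).
    rewrite addrK; apply: eq_bigl => T; by rewrite andbA.
  apply: eq_bigl => T; rewrite -andbA; case: (boolP (T \in _)) => //= Tw.
  by rewrite andbC; case: (boolP (has_R T)) => //= nR; apply: contra nR; apply: has_rR_has_R.
rewrite ePA in eQ; have eQ' := congr1 (msym s) eQ.
rewrite symQ msymM msymN msym_var tpermL msymB symP in eQ'.
move: eQ eQ'.
move: (\sum_(T in _ | has_rR T) _) => Q.
move: (msym s _) => A'.
move: (\sum_(T in _ | ~~ has_rR T) _) => P.
move: (\sum_(T in _ | ~~ has_R T) _) => A.
move: (mpolyX _ U_(r)) => a.
move: (mpolyX _ U_(R)) => b eQ eQ'.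
have e : a * P - b * P = a * A - b * A'.
  transitivity (a * A - b * A' + (- b * (P - A') - (- a * (P - A)))); first by ring.
  by rewrite -eQ -eQ' subrr addr0.
transitivity (a * (- b * (P - A')) - b * (- a * (P - A)) + (a * P - b * P)).
  by rewrite -eQ -eQ'; ring.
by rewrite e; ring.
Qed.

End FirstAscent.

(** * Induction on the permutation *)

Section MainInduction.
Variable n : nat.
Implicit Type w : 'S_n.

(** The positions (r, R) cannot be two consecutive letters of a pattern 1432 in
    w s_r: being a descent they are not its 1 4, and as no earlier value is
    smaller than w r, there is no 1 for them to be its 4 3 or 3 2. All other
    patterns are carried over to w by s_r. *)
Lemma avoids_1432_swap w (r R : 'I_n) : R = r.+1 :> nat -> (w r < w R)%N ->
  (forall p : 'I_n, (p < r)%N -> (w r < w p)%N) ->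
  avoids_1432 w -> avoids_1432 (tperm r R * w)%g.
Proof.
move=> Rr asc prefix av; apply/negP.
case/existsP => p1 /existsP[p2 /existsP[p3 /existsP[p4]]].
rewrite !permM => /and5P[l12 l23 l34 l14 /andP[l43 l32]].
have wlt (p : 'I_n) : (p < r)%N -> (w (tperm r R R) < w (tperm r R p))%N.
  by move=> pr; rewrite tpermR tpermD; [exact: prefix | | ];
    rewrite -(inj_eq val_inj) /= gtn_eqF ?Rr // ltnW.
have n12 : (p1, p2) != (r, R).
  apply/eqP => -[e1 e2]; subst p1 p2.
  by have := ltn_trans l43 l32; have := l14; rewrite tpermL tpermR; lia.
have n23 : (p2, p3) != (r, R).
  apply/eqP => -[e1 e2]; subst p2 p3.
  by have := ltn_trans (ltn_trans (wlt _ l12) l14) l43; rewrite ltnn.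
have n34 : (p3, p4) != (r, R).
  apply/eqP => -[e1 e2]; subst p3 p4.
  by have := ltn_trans (wlt _ (ltn_trans l12 l23)) l14; rewrite ltnn.
exact: (avoids_1432P av (tperm_lt Rr l12 n12) (tperm_lt Rr l23 n23) (tperm_lt Rr l34 n34)
  l14 l43 l32).
Qed.

Lemma exists_first_ascent w : w != longest_perm n ->
  exists2 i : 'I_n.-1, (w (adj0 i) < w (adj1 i))%N &
    forall p : 'I_n, (p < adj0 i)%N -> (w (adj0 i) < w p)%N.
Proof.
case/exists_ascent => i0 asc0.
case: (@arg_minnP _ i0 (fun i : 'I_n.-1 => w (adj0 i) < w (adj1 i))%N val asc0) => i asc min.
exists i => // p lp.
have desc (q : 'I_n) : (q < i)%N -> exists2 q' : 'I_n, q' = q.+1 :> nat & (w q' < w q)%N.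
  move=> qi; have qn : (q < n.-1)%N by apply: ltn_trans qi (ltn_ord i).
  exists (adj1 (Ordinal qn)) => //.
  have {2}<- : adj0 (Ordinal qn) = q by apply: val_inj.
  rewrite ltn_neqAle (inj_eq val_inj) (inj_eq perm_inj) eq_sym adj01_neq leqNgt.
  by apply/negP => /min /=; rewrite leqNgt qi.
have [m em] : exists m, (p + m.+1 = i)%N by exists (i - p).-1; move: lp => /=; lia.
elim: m p em {lp} => [|m IH] p em; have [q eq lt] := desc p ltac:(lia).
  by rewrite (_ : adj0 i = q) //; apply: val_inj => /=; lia.
by apply: ltn_trans lt; apply: IH; lia.
Qed.

(** All squares of the staircase are frozen, so there is a single tableau. *)
Lemma SVRT_longest_sum :
  \sum_(T in SVRT (longest_perm n) (flag0 n)) weight (longest_perm n) T =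
  \prod_(p : 'I_n * 'I_n | (p.1.+1 + p.2.+1 <= n)%N) 'X_p.1.
Proof.
set w0 := longest_perm n.
have D0 (B : 'I_n * 'I_n) : (B \in rothe_diagram w0) = (B.1.+1 + B.2.+1 <= n)%N.
  case: B => i j; rewrite in_rothe /=.
  have -> : (w0^-1)%g j = rev_ord j.
    by apply: (@perm_inj _ w0); rewrite permKV permE rev_ordK.
  by rewrite permE /=; have := ltn_ord i; have := ltn_ord j; lia.
pose T0 : filling n := [ffun B => if B \in rothe_diagram w0 then [set B.1] else set0].
have in_T0 i j t : (t \in T0 (i, j)) = ((i, j) \in rothe_diagram w0) && (t == i).
  by rewrite ffunE; case: ifP => _; rewrite inE.
have T0w : T0 \in SVRT w0 (flag0 n).
  apply/SVRTP; split.
  - move=> i j; rewrite ffunE; case: ifP => _; last by rewrite eqxx.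
    by apply/set0Pn; exists i; rewrite inE.
  - by move=> i j k s t _; rewrite !in_T0 => /andP[_ /eqP ->] /andP[_ /eqP ->].
  - by move=> i h j s t ih; rewrite !in_T0 => /andP[_ /eqP ->] /andP[_ /eqP ->].
  - by move=> i j t; rewrite !in_T0 => /andP[_ /eqP ->].
rewrite (big_pred1 T0) => [|T].
  rewrite -weightE //.
  rewrite /tableau_size (eq_bigr (fun=> 1%N)) => [|B dB]; last by rewrite ffunE dB cards1.
  rewrite sum1_card card_rothe subnn expr0 mul1r (eq_bigl _ _ D0).
  by apply: eq_bigr => B dB; rewrite ffunE D0 dB big_set1.
apply/idP/eqP => [Tw|-> //]; have [S _ _ _] := SVRTP _ _ Tw.
apply/ffunP => -[i j]; apply/setP => t; rewrite in_T0 -S.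
have froz x : x \in T (i, j) -> x = i.
  move=> xT; apply: (frozen Tw _ xT) => p lp; rewrite D0 /=.
  have : (i, j) \in rothe_diagram w0 by rewrite -S; apply/set0Pn; exists x.
  by rewrite D0 /=; lia.
apply/idP/andP => [tT|[/set0Pn[x xT] /eqP ->]].
  by split; [apply/set0Pn; exists t | apply/eqP/froz].
by rewrite -[X in X \in _](froz x xT).
Qed.

Lemma grothendieck_sum_weight w : avoids_1432 w ->
  grothendieck w = \sum_(T in SVRT w (flag0 n)) weight w T.
Proof.
have [m lem] := ubnP (n ^ 2 - perm_length w); elim: m w lem => // m IH w lem av.
have [->|ne] := eqVneq w (longest_perm n).
  by rewrite grothendieck_longest SVRT_longest_sum.
have [i asc prefix] := exists_first_ascent ne.
have len := perm_length_swap_adj asc; have max := perm_length_max (swap_adj w i).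
have Rr : adj1 i = (adj0 i).+1 :> nat by [].
rewrite (grothendieck_ascent asc) IH.
- by apply/esym/isobaric_difference_unique; exact: sum_SVRT_isobaric Rr asc prefix av.
- by rewrite len in max *; lia.
- exact: avoids_1432_swap Rr asc prefix av.
Qed.

End MainInduction.

Theorem corollary1p2 (n : nat) (w : 'S_n) (w_avoids : avoids_1432 w) :
  grothendieck w =
    \sum_(T in SVRT w (flag0 n))
      (-1) ^+ (tableau_size w T - perm_length w) *
      \prod_(B in rothe_diagram w) \prod_(t in T B) 'X_t.
Proof.
rewrite grothendieck_sum_weight //; apply: eq_bigr => T Tw; exact/esym/weightE.
Qed.
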